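(* Let \[\eta_0=0,\quad \eta_1=1,\quad \eta_2=\sqrt{\tfrac43},\quad \eta_3=\tfrac{1+\sqrt2}{2},\quad \eta_4=\tfrac1{15}\sqrt{169+38\sqrt{19}},\quad \eta_5=\sqrt{\tfrac32},\quad \eta_6=\tfrac25\sqrt{5+2\sqrt5},\] so that $\eta_0<\eta_1<\dots<\eta_6$. Let $\mathcal N$ be the set of all finite Schur norms $\|A\|_\bullet$ of infinite matrices $A=[a_{ij}]_{i,j\in\mathbb N}$ with every $a_{ij}\in\{0,1\}$ (i.e. the set of norms of all bounded idempotent Schur multipliers on $\mathcal B(\ell^2)$). Then \[\{\eta_0,\eta_1,\eta_2,\eta_3,\eta_4,\eta_5,\eta_6\}\subseteq \mathcal N\subseteq \{\eta_0,\eta_1,\eta_2,\eta_3,\eta_4,\eta_5\}\cup[\eta_6,\infty).\] In particular each open interval $(\eta_{j-1},\eta_j)$, $1\le j\le 6$, is disjoint from $\mathcal N$.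
   Context: Fix $\mathbb F\in\{\mathbb R,\mathbb C\}$. For $m,n\in\mathbb N\cup\{\aleph_0\}$, let $\mathcal B=\mathcal B(\ell^2_n,\ell^2_m)$ be the space of $m\times n$ matrices with entries in $\mathbb F$ defining bounded operators $\ell^2_n\to\ell^2_m$ (with operator norm). For an $m\times n$ matrix $A$, the Schur (entrywise) product is $A\bullet X=[a_{ij}x_{ij}]$, and the Schur norm is $\|A\|_\bullet=\sup\{\|A\bullet X\|:X\in\mathcal B,\ \|X\|\le 1\}\in[0,\infty]$ (for infinite matrices, $\|A\|_\bullet=\infty$ if $A\bullet X$ fails to be bounded for some $X\in\mathcal B$; equivalently $\|A\|_\bullet$ is the supremum of the Schur norms of its finite upper-left corners). $A$ is a (bounded) Schur multiplier if $\|A\|_\bullet<\infty$. *)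

(* Defs.v *)
From HB Require Import structures.
From mathcomp Require Import all_boot all_order all_algebra.
From mathcomp Require Import all_classical all_reals ereal.
From mathcomp Require Import complex.
Set Implicit Arguments. Unset Strict Implicit. Unset Printing Implicit Defensive.
Import Order.TTheory GRing.Theory Num.Theory.
Local Open Scope classical_set_scope.
Local Open Scope ring_scope.

Section SchurNorm.
(* [F] is the scalar field (R or C); [nrm : F -> R] is its modulus. *)
Variables (R : realType) (F : pzRingType) (nrm : F -> R).

Definition vnorm n (v : 'cV[F]_n) : R := Num.sqrt (\sum_(i < n) nrm (v i ord0) ^+ 2).

Definition opnorm m n (X : 'M[F]_(m, n)) : R :=
  sup [set vnorm (X *m v) | v in [set v : 'cV[F]_n | vnorm v <= 1]].

Definition schur_prod m n (A X : 'M[F]_(m, n)) : 'M[F]_(m, n) :=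
  \matrix_(i, j) (A i j * X i j).

Definition schur_norm_fin m n (A : 'M[F]_(m, n)) : R :=
  sup [set opnorm (schur_prod A X) | X in [set X : 'M[F]_(m, n) | opnorm X <= 1]].

Definition corner (a : nat -> nat -> bool) (N : nat) : 'M[F]_N :=
  \matrix_(i < N, j < N) (a i j)%:R.

Definition schur_norm01 (a : nat -> nat -> bool) : \bar R :=
  ereal_sup [set (schur_norm_fin (corner a N))%:E | N in [set: nat]].

Definition idem_schur_norms : set R :=
  [set r : R | exists a : nat -> nat -> bool, schur_norm01 a = r%:E].

End SchurNorm.

Definition NormsR (R : realType) : set R :=
  @idem_schur_norms R R (fun x : R => `|x|).

Definition NormsC (R : realType) : set R :=
  @idem_schur_norms R R[i] (@Normc.normc R).

Definition schur_eta (R : realType) (k : nat) : R :=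
  match k with
  | 0 => 0
  | 1 => 1
  | 2 => Num.sqrt (4 / 3)
  | 3 => (1 + Num.sqrt 2) / 2
  | 4 => 15^-1 * Num.sqrt (169 + 38 * Num.sqrt 19)
  | 5 => Num.sqrt (3 / 2)
  | _ => 2 / 5 * Num.sqrt (5 + 2 * Num.sqrt 5)
  end.

(* Main.v *)
Require Import Defs.
From HB Require Import structures.
From Stdlib Require Import BinInt.
From mathcomp Require Import ring lra zify ssrZ.
From mathcomp Require Import all_boot all_order all_algebra.
From mathcomp Require Import all_classical all_reals ereal.
From mathcomp Require Import complex.
Import Order.TTheory GRing.Theory Num.Theory.
Local Open Scope classical_set_scope.
Local Open Scope ring_scope.
Set Implicit Arguments. Unset Strict Implicit. Unset Printing Implicit Defensive.

(** A factorization [a_ij = sum_k d_k u_ik v_jk] with [sum_k d_k u_ik^2 <= c] and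
    [sum_k d_k v_jk^2 <= c] bounds the Schur norm by [c] (Grothendieck's criterion), while a
    matrix [M] whose block matrix [[diag p, M], [M^T, diag q]] is positive semidefinite
    bounds it from below by [sum a_ij M_ij / sqrt (sum p * sum q)].

    View a 0/1 matrix as a bipartite graph. Eight small graphs (up to exchanging rows and
    columns) have norm at least [eta_6]. A graph containing none of them is a disjoint union
    of blow-ups of ten graphs: the edge, the paths on 4 to 7 vertices, the 8-cycle and the
    spiders with legs (1,2,2), (1,2,3), (1,3,3) and (2,2,2). Indeed, if [H] is one of the ten
    occurring in the graph and none of the larger ones occurs, then every vertex is a twin of
    a vertex of [H] or has no neighbour in [H], and the component of [H] is a blow-up of [H];
    this amounts to a finite check on extensions of [H] by one or two vertices. Blow-ups and
    disjoint unions preserve factorizations, so the norm is the largest of the norms of the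
    pieces, which are [eta_1], ..., [eta_5]. *)

(** * Certificates for Schur norms *)

(** With [P] the mixed sum and [S], [T] the two square sums, expanding the nonnegative sum of d_k (T
    x_k - P y_k)^2 gives T (S T - P^2). If [T] vanishes, so does every d_k y_k. *)
Lemma weighted_cauchy (R : realFieldType) (K : finType) (d x y : K -> R) :
    (forall k, 0 <= d k) ->
  (\sum_k d k * (x k * y k)) ^+ 2
    <= (\sum_k d k * x k ^+ 2) * (\sum_k d k * y k ^+ 2).
Proof.
move=> d0; set P := \sum_k _; set S := \sum_k _; set T := \sum_k _.
have T0 : 0 <= T by apply: sumr_ge0 => k _; rewrite mulr_ge0 ?sqr_ge0.
have [Tp|] := ltP 0 T; last first.
  move=> Tn; have T00 : T = 0 by apply/le_anti; rewrite T0 Tn.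
  have dy k : d k * y k = 0.
    have /eqP : d k * y k ^+ 2 = 0.
      apply: (psumr_eq0P _ T00) => // i _; by rewrite mulr_ge0 ?sqr_ge0.
    by rewrite mulf_eq0 expf_eq0 /= => /orP[] /eqP ->; rewrite ?mul0r ?mulr0.
  have -> : P = 0 by rewrite /P big1// => k _; rewrite mulrCA dy mulr0.
  by rewrite T00 mulr0 expr0n.
have : 0 <= \sum_k d k * (T * x k - P * y k) ^+ 2.
  by apply: sumr_ge0 => k _; rewrite mulr_ge0 ?sqr_ge0.
have E a b : \sum_k d k * (a * x k - b * y k) ^+ 2 = a ^+ 2 * S - 2 * a * b * P + b ^+ 2 * T.
  rewrite !mulr_sumr -sumrB -big_split /=.
  by apply: eq_bigr => k _; ring.
rewrite E; have -> : T ^+ 2 * S - 2 * T * P * P + P ^+ 2 * T = T * (S * T - P ^+ 2) by ring.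
by rewrite pmulr_rge0// subr_ge0.
Qed.

Section Certificates.
Variable R : realType.

(** The weights [d] keep square roots out of the certificates. Since [I] and [J] may be infinite, a
    finite pattern extended by zeros to all of [nat] can be factored too. *)
Definition factors (I J : Type) (A : I -> J -> bool) (c : R) : Prop :=
  exists (K : finType) (d : K -> R) (u : I -> K -> R) (v : J -> K -> R),
    [/\ forall k, 0 <= d k,
        forall i j, \sum_k d k * (u i k * v j k) = (A i j)%:R,
        forall i, \sum_k d k * u i k ^+ 2 <= c
      & forall j, \sum_k d k * v j k ^+ 2 <= c].

(** The vanishing conditions make M_ij / sqrt (p_i q_j) meaningful with division by zero read as 0.
    This quotient is the contraction on which the Schur multiplier will be tested. *)
Definition dual_witness (I J : finType) (A : I -> J -> bool) (c : R) : Prop :=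
  exists (M : I -> J -> R) (p : I -> R) (q : J -> R),
    [/\ (forall i, 0 <= p i) /\ (forall j, 0 <= q j),
        (forall i j, p i = 0 -> M i j = 0) /\ (forall i j, q j = 0 -> M i j = 0),
        0 < \sum_i p i /\ 0 < \sum_j q j,
        forall x y, \sum_i \sum_j M i j * (x i * y j)
           <= (\sum_i p i * x i ^+ 2 + \sum_j q j * y j ^+ 2) / 2
      & c * (Num.sqrt (\sum_i p i) * Num.sqrt (\sum_j q j))
          <= \sum_i \sum_j (A i j)%:R * M i j].

Lemma factors_le (I J : Type) (A : I -> J -> bool) c c' :
  c <= c' -> factors A c -> factors A c'.
Proof.
move=> cc [K [d [u [v [d0 uv uc vc]]]]]; exists K, d, u, v.
by split=> // i; apply: le_trans cc.
Qed.

Lemma factors_transpose (I J : Type) (A : I -> J -> bool) c :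
  factors A c -> factors (fun j i => A i j) c.
Proof.
move=> [K [d [u [v [d0 uv uc vc]]]]]; exists K, d, v, u; split=> // j i.
by rewrite -uv; apply: eq_bigr => k _; rewrite (mulrC (v j k)).
Qed.

Lemma factors0 (I J : Type) (A : I -> J -> bool) :
  (forall i j, A i j = false) -> factors A 0.
Proof.
move=> A0; exists void, (fun=> 0), (fun _ _ => 0), (fun _ _ => 0).
split=> //.
- by move=> i j; rewrite A0 big1// => k; rewrite mul0r.
- by move=> i; rewrite big1// => k; rewrite mul0r.
- by move=> i; rewrite big1// => k; rewrite mul0r.
Qed.

(** Factors [A] as the identity times [A]. The crude bound serves to show that the set whose
    supremum is the Schur norm is bounded. *)
Lemma factors_exist (I J : finType) (A : I -> J -> bool) :
  factors A (#|I|%:R + 1).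
Proof.
exists I, (fun=> 1), (fun i k => (k == i)%:R), (fun j k => (A k j)%:R).
split=> //.
- move=> i j; rewrite (bigD1 i)//= eqxx !mul1r big1 ?addr0// => k /negbTE ->.
  by rewrite mul0r mulr0.
- move=> i; rewrite (bigD1 i)//= eqxx mul1r expr1n big1 ?addr0 => [|k /negbTE ->].
    by rewrite lerDr.
  by rewrite expr0n mulr0.
- move=> j; apply: (@le_trans _ _ (\sum_(k : I) 1)).
    by apply: ler_sum => k _; case: (A k j); rewrite ?expr1n ?expr0n ?mulr1 ?mulr0.
  by rewrite sumr_const cardT /= -cardE lerDl.
Qed.

Lemma dual_witness_transpose (I J : finType) (A : I -> J -> bool) c :
  dual_witness A c -> dual_witness (fun j i => A i j) c.
Proof.
move=> [M [p [q [[p0 q0] [pM qM] [sp sq] b v]]]].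
exists (fun j i => M i j), q, p; split=> //.
- by split=> j i; [exact: qM|exact: pM].
- move=> x y; rewrite exchange_big /= addrC.
  rewrite (_ : \sum_j _ = \sum_i \sum_j M i j * (y i * x j)); first exact: b.
  by apply: eq_bigr => i _; apply: eq_bigr => j _; rewrite (mulrC (x j)).
- by rewrite [leRHS]exchange_big /= (mulrC (Num.sqrt (\sum_j q j))).
Qed.

Lemma pushforward_sum (I I' : finType) (f : I -> I') (p : I -> R) (F : I' -> R) :
  \sum_x (\sum_i (f i == x)%:R * p i) * F x = \sum_i p i * F (f i).
Proof.
under eq_bigr => x _ do rewrite mulr_suml.
rewrite exchange_big /=; apply: eq_bigr => i _.
rewrite (bigD1 (f i))//= eqxx mul1r big1 ?addr0// => x.
by rewrite eq_sym => /negbTE ->; rewrite !mul0r.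
Qed.

(** All data are summed over the fibres of [f] and [g]. Testing the new form on [x], [y] is testing
    the old one on the compositions with [f], [g], and masses and value are unchanged. *)
Lemma dual_witness_sub (I J I' J' : finType) (A : I -> J -> bool)
    (A' : I' -> J' -> bool) (f : I -> I') (g : J -> J') c :
  (forall i j, A' (f i) (g j) = A i j) -> dual_witness A c -> dual_witness A' c.
Proof.
move=> AA' [M [p [q [[p0 q0] [pM qM] [sp sq] b v]]]].
pose p' x := \sum_i (f i == x)%:R * p i.
pose q' y := \sum_j (g j == y)%:R * q j.
pose M' x y := \sum_i (f i == x)%:R * (\sum_j (g j == y)%:R * M i j).
have sM (F : I' -> J' -> R) :
    \sum_x \sum_y M' x y * F x y = \sum_i \sum_j M i j * F (f i) (g j).
  transitivity (\sum_y \sum_x M' x y * F x y); first by rewrite exchange_big.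
  rewrite [RHS](eq_bigr (fun i => \sum_y (\sum_j (g j == y)%:R * M i j) * F (f i) y)).
    rewrite [RHS]exchange_big; apply: eq_bigr => y _ /=.
    exact: (pushforward_sum f (fun i => \sum_j (g j == y)%:R * M i j) (fun x => F x y)).
  by move=> i _; rewrite (pushforward_sum g (M i) (F (f i))).
have E1 x : (\sum_i p' i = \sum_i p i) * (\sum_i p' i * x i = \sum_i p i * x (f i)).
  split; last exact: pushforward_sum.
  transitivity (\sum_i p' i * 1); first by apply: eq_bigr => i _; rewrite mulr1.
  by rewrite pushforward_sum; apply: eq_bigr => i _; rewrite mulr1.
have E2 x : (\sum_i q' i = \sum_i q i) * (\sum_i q' i * x i = \sum_i q i * x (g i)).
  split; last exact: pushforward_sum.
  transitivity (\sum_i q' i * 1); first by apply: eq_bigr => i _; rewrite mulr1.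
  by rewrite pushforward_sum; apply: eq_bigr => i _; rewrite mulr1.
exists M', p', q'; split.
- by split=> x; apply: sumr_ge0 => i _; rewrite mulr_ge0.
- split=> x y.
    move=> px; apply: big1 => i _.
    have /eqP : (f i == x)%:R * p i = 0 by apply: (psumr_eq0P _ px) => // k _; rewrite mulr_ge0.
    rewrite mulf_eq0 => /orP[/eqP ->|/eqP pi0]; first by rewrite mul0r.
    by rewrite [X in _ * X]big1 ?mulr0// => j _; rewrite pM// mulr0.
  move=> qy; apply: big1 => i _; rewrite [X in _ * X]big1 ?mulr0// => j _.
  have /eqP : (g j == y)%:R * q j = 0 by apply: (psumr_eq0P _ qy) => // k _; rewrite mulr_ge0.
  by rewrite mulf_eq0 => /orP[/eqP ->|/eqP qj0]; rewrite ?mul0r ?qM ?mulr0.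
- by rewrite (E1 (fun=> 0)) (E2 (fun=> 0)).
- move=> x y; rewrite sM (E1 (fun i => x i ^+ 2)) (E2 (fun i => y i ^+ 2)).
  exact: (b (x \o f) (y \o g)).
- rewrite (E1 (fun=> 0)) (E2 (fun=> 0)); apply: le_trans v _.
  under [leRHS]eq_bigr => x _ do under eq_bigr => y _ do rewrite mulrC.
  rewrite sM; under [leRHS]eq_bigr => x _ do under eq_bigr => y _ do rewrite mulrC.
  by under [leRHS]eq_bigr => x _ do under eq_bigr => y _ do rewrite AA'.
Qed.

End Certificates.

(* Lets real and complex scalars be treated at once: [io] embeds the reals in [F], and
   [re], [im] are the real coordinates ([im = 0] when [F] is the field of reals). *)
Record real_modulus (R : realType) (F : pzRingType) (nrm re im : F -> R)
    (io : {rmorphism R -> F}) : Prop := RealModulus {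
  modulusE : forall x, nrm x = Num.sqrt (re x ^+ 2 + im x ^+ 2);
  modulusM : forall x y, nrm (x * y) = nrm x * nrm y;
  modulus_reD : forall x y, re (x + y) = re x + re y;
  modulus_imD : forall x y, im (x + y) = im x + im y;
  modulus_reZ : forall r x, re (io r * x) = r * re x;
  modulus_imZ : forall r x, im (io r * x) = r * im x;
  modulus_re1 : re 1 = 1;
  modulus_im1 : im 1 = 0;
  modulus_comm : forall r x, x * io r = io r * x }.

(** * Bounds on Schur norms over real or complex scalars *)

Section SchurBounds.
Variables (R : realType) (F : pzRingType) (nrm re im : F -> R) (io : {rmorphism R -> F}).
Hypothesis nrmP : real_modulus nrm re im io.

Let nrmE := modulusE nrmP.
Let nrmM := modulusM nrmP.
Let reD := modulus_reD nrmP.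
Let imD := modulus_imD nrmP.
Let re_io := modulus_reZ nrmP.
Let im_io := modulus_imZ nrmP.
Let re1 := modulus_re1 nrmP.
Let im1 := modulus_im1 nrmP.
Let io_comm := modulus_comm nrmP.

Let sqN x := re x ^+ 2 + im x ^+ 2.
Let n2 n (v : 'cV[F]_n) : R := \sum_i sqN (v i ord0).

Let sqN_ge0 x : 0 <= sqN x.
Proof. by rewrite addr_ge0 ?sqr_ge0. Qed.

Let n2_ge0 n (v : 'cV[F]_n) : 0 <= n2 v.
Proof. by apply: sumr_ge0 => i _; apply: sqN_ge0. Qed.

#[local] Hint Resolve sqN_ge0 n2_ge0 : core.

Let re0 : re 0 = 0.
Proof. by have := re_io 0 0; rewrite mulr0 mul0r. Qed.

Let im0 : im 0 = 0.
Proof. by have := im_io 0 0; rewrite mulr0 mul0r. Qed.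

Let re_sum (I : finType) (G : I -> F) : re (\sum_i G i) = \sum_i re (G i).
Proof. exact: (big_morph re reD re0). Qed.

Let im_sum (I : finType) (G : I -> F) : im (\sum_i G i) = \sum_i im (G i).
Proof. exact: (big_morph im imD im0). Qed.

Let sqN_io r : sqN (io r) = r ^+ 2.
Proof.
by rewrite /sqN -[io r]mulr1 re_io im_io re1 im1 mulr1 mulr0 expr0n addr0.
Qed.

Let sqN_ioM r x : sqN (io r * x) = r ^+ 2 * sqN x.
Proof. by rewrite /sqN re_io im_io !exprMn mulrDr. Qed.

Let nrm_sq x : nrm x ^+ 2 = sqN x.
Proof. by rewrite nrmE sqr_sqrtr //; apply: sqN_ge0. Qed.

Let sqNM x y : sqN (x * y) = sqN x * sqN y.
Proof. by rewrite -!nrm_sq nrmM exprMn. Qed.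

Let vnormE n (v : 'cV[F]_n) : vnorm nrm v = Num.sqrt (n2 v).
Proof. by rewrite /vnorm; congr Num.sqrt; apply: eq_bigr => i _; rewrite nrm_sq. Qed.

Let sqr_sum_le (n : nat) (x : 'I_n -> R) : (\sum_i x i) ^+ 2 <= n%:R * \sum_i x i ^+ 2.
Proof.
have := @weighted_cauchy R _ (fun=> 1) (fun=> 1) x (fun=> ler01).
have -> : \sum_i 1 * (1 * x i) = \sum_i x i by apply: eq_bigr => i _; rewrite !mul1r.
have -> : \sum_(i < n) 1 * 1 ^+ 2 = n%:R :> R.
  by under eq_bigr do rewrite mul1r expr1n; rewrite sumr_const card_ord.
by under [X in _ * X]eq_bigr do rewrite mul1r.
Qed.

Let n2_mulmx_bound m n (X : 'M[F]_(m, n)) :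
  exists2 C, 0 <= C & forall v, n2 (X *m v) <= C * n2 v.
Proof.
exists (\sum_i n%:R * \sum_j sqN (X i j)).
  by apply: sumr_ge0 => i _; rewrite mulr_ge0// sumr_ge0.
move=> v; rewrite mulr_suml; apply: ler_sum => i _; rewrite mxE {1}/sqN re_sum im_sum.
apply: (@le_trans _ _ (n%:R * \sum_j sqN (X i j * v j ord0))).
  by rewrite /sqN big_split mulrDr lerD// sqr_sum_le.
rewrite -mulrA ler_wpM2l// mulr_suml ler_sum// => j _; rewrite sqNM ler_wpM2l//.
by rewrite /n2 (bigD1 j)//= lerDl sumr_ge0.
Qed.

Let opnorm_has_ub m n (X : 'M[F]_(m, n)) :
  has_ubound [set vnorm nrm (X *m v) | v in [set v : 'cV[F]_n | vnorm nrm v <= 1]].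
Proof.
have [C C0 XC] := n2_mulmx_bound X; exists (Num.sqrt C) => _ [v /= v1 <-].
rewrite vnormE ler_sqrt//; apply: le_trans (XC v) _.
rewrite -[leRHS]mulr1 ler_wpM2l//.
by move: v1; rewrite vnormE -[X in _ <= X]sqrtr1 ler_sqrt// ler01.
Qed.

Let opnorm_ge m n (X : 'M[F]_(m, n)) v : n2 v <= 1 -> vnorm nrm (X *m v) <= opnorm nrm X.
Proof.
move=> v1; apply: ub_le_sup; first exact: opnorm_has_ub.
by exists v => //=; rewrite vnormE -[X in _ <= X]sqrtr1 ler_sqrt.
Qed.

Let opnorm_le m n (X : 'M[F]_(m, n)) c :
  0 <= c -> (forall v, n2 (X *m v) <= c ^+ 2 * n2 v) -> opnorm nrm X <= c.
Proof.
move=> c0 Xc; apply: ge_sup.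
  exists (vnorm nrm (X *m 0)); exists 0 => //=.
  by rewrite vnormE /n2 big1 ?sqrtr0// => i _; rewrite mxE /sqN re0 im0 expr0n addr0.
move=> _ [v /= v1 <-]; rewrite vnormE -[leRHS]ger0_norm// -sqrtr_sqr ler_sqrt ?sqr_ge0//.
apply: le_trans (Xc v) _; rewrite -[leRHS]mulr1 ler_wpM2l ?sqr_ge0//.
by move: v1; rewrite vnormE -[X in _ <= X]sqrtr1 ler_sqrt// ler01.
Qed.

Let opnorm_le1 m n (X : 'M[F]_(m, n)) :
  opnorm nrm X <= 1 -> forall v, n2 (X *m v) <= n2 v.
Proof.
(* A vector of length 0 cannot be normalized; the crude bound on [X] covers it. *)
move=> X1 v; have [v0|] := eqVneq (n2 v) 0.
  by have [C C0 /(_ v)] := n2_mulmx_bound X; rewrite v0 mulr0.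
move=> vn0; have vp : 0 < n2 v by rewrite lt_def vn0 n2_ge0.
pose t := (Num.sqrt (n2 v))^-1.
have t2 : t ^+ 2 = (n2 v)^-1 by rewrite exprVn sqr_sqrtr.
pose w : 'cV[F]_n := \col_j (io t * v j ord0).
have w1 : n2 w <= 1.
  rewrite /n2; under eq_bigr => j _ do rewrite mxE sqN_ioM t2.
  by rewrite -mulr_sumr mulVf.
have := le_trans (opnorm_ge X w1) X1.
have -> : n2 v = n2 v * 1 by rewrite mulr1.
rewrite vnormE -[X in _ <= X]sqrtr1 ler_sqrt// => Xw.
rewrite -ler_pdivrMl//; apply: le_trans Xw.
rewrite -t2 /n2 mulr_sumr ler_sum// => i _; rewrite -sqN_ioM !mxE mulr_sumr.
rewrite le_eqVlt; apply/orP; left; apply/eqP; congr sqN; apply: eq_bigr => j _.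
by rewrite mxE !mulrA io_comm.
Qed.

Variables (m n : nat) (a : 'I_m -> 'I_n -> bool).
Let Amx : 'M[F]_(m, n) := \matrix_(i, j) (a i j)%:R.

(** Coordinate i of the image of [w] is the sum of d_k u_ik times coordinate i of X (v_k w).
    Cauchy-Schwarz in k yields one factor [c] from the rows; contractivity of [X], applied for each
    k, and the column bound yield the other. *)
Let schur_prod_bound c (X : 'M[F]_(m, n)) :
    0 <= c -> factors a c -> (forall v, n2 (X *m v) <= n2 v) ->
  forall w, n2 (schur_prod Amx X *m w) <= c ^+ 2 * n2 w.
Proof.
move=> c0 [K [d [u [v [d0 uv uc vc]]]]] X1 w.
pose wk k : 'cV[F]_n := \col_j (io (v j k) * w j ord0).
(* [G] stands for [re] or [im]: the factorization is real, so it acts on the two coordinates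
   separately. *)
have entry (G : F -> R) : (forall (I : finType) (H : I -> F), G (\sum_i H i) = \sum_i G (H i)) ->
    (forall r x, G (io r * x) = r * G x) -> G 0 = 0 -> forall i,
    G ((schur_prod Amx X *m w) i ord0) = \sum_k d k * (u i k * G ((X *m wk k) i ord0)).
  move=> GS Gio G0 i; rewrite mxE GS.
  transitivity (\sum_j \sum_k d k * (u i k * (v j k * G (X i j * w j ord0)))).
    apply: eq_bigr => j _; rewrite !mxE.
    transitivity ((a i j)%:R * G (X i j * w j ord0)).
      by case: (a i j); rewrite ?mul1r// !mul0r G0.
    by rewrite -uv mulr_suml; apply: eq_bigr => k _; rewrite !mulrA.
  rewrite exchange_big; apply: eq_bigr => k _ /=; rewrite -!mulr_sumr; congr (_ * (_ * _)).
  rewrite mxE GS; apply: eq_bigr => j _.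
  by rewrite mxE mulrA io_comm -mulrA Gio.
have E i : sqN ((schur_prod Amx X *m w) i ord0) <= c * \sum_k d k * sqN ((X *m wk k) i ord0).
  rewrite {1}/sqN (entry re)// (entry im)//.
  have S0 (x : K -> R) : 0 <= \sum_k d k * x k ^+ 2.
    by apply: sumr_ge0 => k _; rewrite mulr_ge0 ?sqr_ge0.
  apply: (@le_trans _ _ ((\sum_k d k * u i k ^+ 2) * \sum_k d k * sqN ((X *m wk k) i ord0))).
    rewrite /sqN; under [X in _ <= _ * X]eq_bigr => k _ do rewrite mulrDr.
    by rewrite big_split mulrDr lerD// weighted_cauchy.
  by rewrite ler_wpM2r// sumr_ge0// => k _; rewrite mulr_ge0.
apply: (@le_trans _ _ (\sum_i c * \sum_k d k * sqN ((X *m wk k) i ord0))).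
  by apply: ler_sum.
rewrite -mulr_sumr expr2 -mulrA ler_wpM2l// exchange_big /=.
apply: (@le_trans _ _ (\sum_k d k * n2 (wk k))).
  by apply: ler_sum => k _; rewrite -mulr_sumr ler_wpM2l//; apply: X1.
rewrite /n2 mulr_sumr; under eq_bigr => k _ do rewrite mulr_sumr.
rewrite exchange_big /=; apply: ler_sum => j _.
apply: (@le_trans _ _ ((\sum_k d k * v j k ^+ 2) * sqN (w j ord0))); last by rewrite ler_wpM2r.
by rewrite mulr_suml; apply: ler_sum => k _; rewrite mxE sqN_ioM mulrA.
Qed.

Let zero_in : opnorm nrm (0 : 'M[F]_(m, n)) <= 1.
Proof.
apply: opnorm_le => // v; rewrite mul0mx /n2 big1 ?mulr_ge0 ?sqr_ge0 ?sumr_ge0// => i _.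
by rewrite mxE /sqN re0 im0 expr0n addr0.
Qed.

Lemma schur_norm_le c : 0 <= c -> factors a c -> schur_norm_fin nrm Amx <= c.
Proof.
move=> c0 fc; apply: ge_sup; first by exists (opnorm nrm (schur_prod Amx 0)), 0.
move=> _ [X /= X1 <-]; apply: opnorm_le => //.
by apply: schur_prod_bound => //; apply: opnorm_le1.
Qed.

Let schur_has_ub :
  has_ubound [set opnorm nrm (schur_prod Amx X) | X in [set X : 'M[F]_(m, n) | opnorm nrm X <= 1]].
Proof.
have fA := factors_exist R a; exists (#|'I_m|%:R + 1) => _ [Y /= Y1 <-].
have c0 : 0 <= #|'I_m|%:R + 1 :> R by rewrite addr_ge0.
by apply: opnorm_le => //; apply: schur_prod_bound => //; apply: opnorm_le1.
Qed.

Lemma schur_norm_ge0 : 0 <= schur_norm_fin nrm Amx.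
Proof.
apply: (@le_trans _ _ (opnorm nrm (schur_prod Amx 0))).
  apply: (@le_trans _ _ (vnorm nrm (schur_prod Amx 0 *m 0))); first by rewrite vnormE sqrtr_ge0.
  by apply: opnorm_ge; rewrite /n2 big1// => i _; rewrite mxE /sqN re0 im0 expr0n addr0.
by apply: ub_le_sup; [exact: schur_has_ub|exists 0].
Qed.

(** The form inequality says that X_ij = M_ij / sqrt (p_i q_j) is a contraction. Pairing its Schur
    product with the unit vectors sqrt p_i / P and sqrt q_j / Q gives the sum of A_ij M_ij divided
    by P Q, which is at least [c]. *)
Lemma schur_norm_ge c : dual_witness a c -> c <= schur_norm_fin nrm Amx.
Proof.
move=> [M [p [q [[p0 q0] [pM qM] [sp sq] b val]]]].
pose P := Num.sqrt (\sum_i p i); pose Q := Num.sqrt (\sum_j q j).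
have [sp0 sq0] := (ltW sp, ltW sq).
have Pp : 0 < P by rewrite sqrtr_gt0.
have Qp : 0 < Q by rewrite sqrtr_gt0.
pose X i j := M i j / (Num.sqrt (p i) * Num.sqrt (q j)).
(* Only an inequality, because at [r = 0] the quotient is 0. *)
have scale (r x : R) : 0 <= r -> r * (x / Num.sqrt r) ^+ 2 <= x ^+ 2.
  move=> r0; have [->|rn0] := eqVneq r 0; first by rewrite mul0r sqr_ge0.
  by rewrite exprMn exprVn sqr_sqrtr// mulrCA mulfV// mulr1.
have bX x y : \sum_i \sum_j X i j * (x i * y j) <= (\sum_i x i ^+ 2 + \sum_j y j ^+ 2) / 2.
  have := b (fun i => x i / Num.sqrt (p i)) (fun j => y j / Num.sqrt (q j)).
  rewrite (_ : \sum_i _ = \sum_i \sum_j X i j * (x i * y j)); last first.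
    by apply: eq_bigr => i _; apply: eq_bigr => j _; rewrite /X invfM; ring.
  move=> /le_trans; apply; rewrite ler_pM2r ?invr_gt0//.
  by apply: lerD; apply: ler_sum => i _; apply: scale.
(* Putting x = X y in the bilinear bound gives |Xy|^2 <= (|Xy|^2 + |y|^2) / 2. *)
have cX y : \sum_i (\sum_j X i j * y j) ^+ 2 <= \sum_j y j ^+ 2.
  have := bX (fun i => \sum_j X i j * y j) y.
  rewrite (_ : \sum_i _ = \sum_i (\sum_j X i j * y j) ^+ 2); first by lra.
  apply: eq_bigr => i _; rewrite expr2 mulr_sumr; apply: eq_bigr => j _; ring.
pose XF : 'M[F]_(m, n) := \matrix_(i, j) io (X i j).
have XF1 : opnorm nrm XF <= 1.
  apply: opnorm_le => // v; rewrite expr1n mul1r /n2 /sqN !big_split /=.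
  (* A real matrix acts separately on real and imaginary coordinates, so the real contraction bound
     applies to each. *)
  have h (G : F -> R) : (forall (I : finType) (H : I -> F), G (\sum_i H i) = \sum_i G (H i)) ->
      (forall r x, G (io r * x) = r * G x) ->
      \sum_i G ((XF *m v) i ord0) ^+ 2 <= \sum_i G (v i ord0) ^+ 2.
    move=> GS Gio; apply: le_trans (cX _); apply: ler_sum => i _.
    by rewrite mxE GS; under eq_bigr => j _ do rewrite mxE Gio.
  by apply: lerD; apply: h.
pose z i := \sum_j (a i j)%:R * X i j * (Num.sqrt (q j) / Q).
pose w : 'cV[F]_n := \col_j io (Num.sqrt (q j) / Q).
have w1 : n2 w <= 1.
  rewrite /n2; under eq_bigr => j _ do rewrite mxE sqN_io exprMn exprVn !sqr_sqrtr//.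
  by rewrite -mulr_suml mulfV// gt_eqF.
have zE : n2 (schur_prod Amx XF *m w) = \sum_i z i ^+ 2.
  apply: eq_bigr => i _; rewrite mxE -sqN_io; congr sqN.
  rewrite rmorph_sum; apply: eq_bigr => j _; rewrite !mxE !rmorphM.
  by rewrite rmorph_nat.
have cz : c <= Num.sqrt (\sum_i z i ^+ 2).
  have y1 : \sum_i (Num.sqrt (p i) / P) ^+ 2 = 1.
    under eq_bigr => j _ do rewrite exprMn exprVn !sqr_sqrtr//.
    by rewrite -mulr_suml mulfV// gt_eqF.
  apply: (@le_trans _ _ (\sum_i 1 * (z i * (Num.sqrt (p i) / P)))).
    rewrite -(ler_pM2r (mulr_gt0 Pp Qp)); apply: le_trans val _.
    rewrite mulr_suml; apply: ler_sum => i _; rewrite mul1r 2!mulr_suml.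
    apply: ler_sum => j _; rewrite /X.
    have [pi0|pi0] := eqVneq (p i) 0; first by rewrite pM// pi0 sqrtr0 !(mul0r, mulr0).
    have [qj0|qj0] := eqVneq (q j) 0; first by rewrite qM// qj0 sqrtr0 !(mul0r, mulr0).
    rewrite le_eqVlt; apply/orP; left; apply/eqP; field.
    by rewrite !gt_eqF//= sqrtr_gt0 lt_def ?p0 ?q0 ?pi0 ?qj0.
  apply: le_trans (ler_norm _) _; rewrite -sqrtr_sqr ler_sqrt; last first.
    by apply: sumr_ge0 => i _; rewrite sqr_ge0.
  apply: le_trans (weighted_cauchy _ _ (fun=> ler01)) _.
  rewrite [X in _ * X](eq_bigr (fun i => (Num.sqrt (p i) / P) ^+ 2)) ?y1 => [|i _].
    by rewrite mulr1; apply: ler_sum => i _; rewrite mul1r.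
  by rewrite mul1r.
apply: le_trans cz _; rewrite -zE -vnormE; apply: le_trans (opnorm_ge _ w1) _.
by apply: ub_le_sup; [exact: schur_has_ub|exists XF].
Qed.

End SchurBounds.

(** * Certificates over quadratic integers *)

Local Notation Zpair := (Z * Z)%type.

Section QuadraticIntegers.
Variable n : Z.

(** A pair (a, b) stands for a + b sqrt n, so that certificates can be verified by integer
    computation. *)
Definition qadd (x y : Zpair) : Zpair := (x.1 + y.1, x.2 + y.2).
Definition qopp (x : Zpair) : Zpair := (- x.1, - x.2).
Definition qmul (x y : Zpair) : Zpair :=
  (x.1 * y.1 + n * (x.2 * y.2), x.1 * y.2 + x.2 * y.1).
Definition qsum (k : nat) (f : nat -> Zpair) : Zpair :=
  foldr qadd (0, 0) [seq f i | i <- iota 0 k].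
(** When a and b differ in sign, a is compared with b sqrt n through squares. *)
Definition qge0 (x : Zpair) : bool :=
  [|| (0 <= x.1) && (0 <= x.2),
      (0 <= x.1) && (n * (x.2 * x.2) <= x.1 * x.1)
    | (0 <= x.2) && (x.1 * x.1 <= n * (x.2 * x.2))].
Definition qgt0 (x : Zpair) : bool :=
  [|| (0 < x.1) && (0 <= x.2),
      (0 < x.1) && (n * (x.2 * x.2) < x.1 * x.1)
    | (0 < x.2) && (x.1 * x.1 < n * (x.2 * x.2))].
Definition qabs (x : Zpair) : Zpair := if qge0 x then x else qopp x.

Variable R : realType.

Definition Zreal (z : Z) : R := (int_of_Z z)%:~R.
Definition qreal (x : Zpair) : R := Zreal x.1 + Zreal x.2 * Num.sqrt (Zreal n).

Lemma Zreal_ge0 z : 0 <= z -> 0 <= Zreal z.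
Proof. by move=> z0; rewrite ler0z; case: z z0. Qed.

Lemma Zreal_gt0 z : 0 < z -> 0 < Zreal z.
Proof. by move=> z0; rewrite ltr0z; case: z z0 => // p _ /=; lia. Qed.

Lemma ZrealD x y : Zreal (x + y) = Zreal x + Zreal y.
Proof. by rewrite /Zreal rmorphD intrD. Qed.

Lemma ZrealN x : Zreal (- x) = - Zreal x.
Proof. by rewrite /Zreal rmorphN mulrNz. Qed.

Lemma ZrealM x y : Zreal (x * y) = Zreal x * Zreal y.
Proof. by rewrite /Zreal rmorphM intrM. Qed.

Lemma Zreal_le x y : x <= y -> Zreal x <= Zreal y.
Proof. by rewrite -subr_ge0 => /Zreal_ge0; rewrite ZrealD ZrealN subr_ge0. Qed.

Lemma Zreal_lt x y : x < y -> Zreal x < Zreal y.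
Proof. by rewrite -subr_gt0 => /Zreal_gt0; rewrite ZrealD ZrealN subr_gt0. Qed.

Hypothesis n_ge0 : 0 <= n.

Let s : R := Num.sqrt (Zreal n).

Let s_ge0 : 0 <= s. Proof. exact: sqrtr_ge0. Qed.

Let s_sq : s * s = Zreal n.
Proof. by rewrite -expr2 sqr_sqrtr// Zreal_ge0. Qed.

Lemma qrealD x y : qreal (qadd x y) = qreal x + qreal y.
Proof. by rewrite /qreal !ZrealD; ring. Qed.

Lemma qrealN x : qreal (qopp x) = - qreal x.
Proof. by rewrite /qreal !ZrealN; ring. Qed.

Lemma qrealM x y : qreal (qmul x y) = qreal x * qreal y.
Proof. by rewrite /qreal -/s !(ZrealD, ZrealM) -s_sq; ring. Qed.

Lemma qreal0 : qreal (0, 0) = 0.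
Proof. by rewrite /qreal /Zreal /= mul0r addr0. Qed.

Lemma qrealZ z : qreal (z, 0) = Zreal z.
Proof. by rewrite /qreal /= /Zreal mul0r addr0. Qed.

Lemma qreal_sum k f : qreal (qsum k f) = \sum_(i < k) qreal (f i).
Proof.
rewrite -(big_mkord xpredT (fun i => qreal (f i))) /index_iota subn0 /qsum.
elim: (iota 0 k) => [|i l IH] /=; first by rewrite big_nil qreal0.
by rewrite big_cons qrealD IH.
Qed.

Lemma qge0P x : qge0 x -> 0 <= qreal x.
Proof.
have nE b : (Zreal b * s) ^+ 2 = Zreal (n * (b * b)).
  by rewrite !ZrealM -s_sq; ring.
have aE a : Zreal a ^+ 2 = Zreal (a * a) by rewrite ZrealM expr2.
rewrite /qreal -/s => /or3P[] /andP[].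
- by move=> /Zreal_ge0 ? /Zreal_ge0 ?; rewrite addr_ge0// mulr_ge0.
- by move=> /Zreal_ge0 a0 /Zreal_le; rewrite -nE -aE; nra.
- move=> /Zreal_ge0 b0 /Zreal_le; rewrite -nE -aE.
  have : 0 <= Zreal x.2 * s by rewrite mulr_ge0.
  by set y := _ * s; nra.
Qed.

Lemma qgt0P x : qgt0 x -> 0 < qreal x.
Proof.
have nE b : (Zreal b * s) ^+ 2 = Zreal (n * (b * b)).
  by rewrite !ZrealM -s_sq; ring.
have aE a : Zreal a ^+ 2 = Zreal (a * a) by rewrite ZrealM expr2.
rewrite /qreal -/s => /or3P[] /andP[].
- by move=> /Zreal_gt0 ? /Zreal_ge0 ?; rewrite ltr_pwDl// mulr_ge0.
- by move=> /Zreal_gt0 a0 /Zreal_lt; rewrite -nE -aE; nra.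
- move=> /Zreal_gt0 b0 /Zreal_lt; rewrite -nE -aE.
  have : 0 <= Zreal x.2 * s by rewrite mulr_ge0// ltW.
  by set y := _ * s; nra.
Qed.

Lemma qle x y : qge0 (qadd y (qopp x)) -> qreal x <= qreal y.
Proof. by move=> /qge0P; rewrite qrealD qrealN subr_ge0. Qed.

(** The premise is evaluated by the checker itself, so soundness of the sign test suffices. *)
Lemma qabsP x : qge0 (qabs x) -> `|qreal x| <= qreal (qabs x).
Proof.
rewrite /qabs; case: ifP => [x0 _|_ /qge0P x0]; first by rewrite ger0_norm// qge0P.
by move: x0; rewrite qrealN => x0; rewrite ler0_norm// -oppr_ge0.
Qed.

End QuadraticIntegers.

Definition pattern := seq (seq bool).
(** The default [false] makes a well-formed pattern an infinite matrix supported in a corner. In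
    particular the indices [nrow B] and [ncol B] serve as a zero row and a zero column. *)
Definition ent (B : pattern) (i j : nat) : bool := nth false (nth [::] B i) j.
Definition nrow (B : pattern) : nat := size B.
Definition ncol (B : pattern) : nat := size (head [::] B).
Definition wf (B : pattern) : bool := all (fun r => size r == ncol B) B.

Lemma ent_row_out B i j : (nrow B <= i)%N -> ent B i j = false.
Proof. by move=> Bi; rewrite /ent [nth _ B i]nth_default// nth_nil. Qed.

Lemma ent_col_out B i j : wf B -> (ncol B <= j)%N -> ent B i j = false.
Proof.
move=> Bw Bj; have [iB|Bi] := ltnP i (nrow B); last exact: ent_row_out.
by rewrite /ent nth_default// (eqP (allP Bw _ (mem_nth [::] iB))).
Qed.

Lemma in_iota0 k i : (i \in iota 0 k) = (i < k)%N.
Proof. by rewrite mem_iota add0n. Qed.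

(* Here [G = W^T diag(p) W]; diagonal dominance gives [G <= diag(q)], so [diag(p) W] is the
   off-diagonal block [M] of a dual witness. *)
Section DualCheck.
Variables (n : Z) (B : pattern) (p : seq Zpair) (W : seq (seq Zpair)) (t : Zpair) (td : Z).
Let r := nrow B.
Let c := ncol B.
Let pf i : Zpair := nth (0, 0) p i.
Let Wf i j : Zpair := nth (0, 0) (nth [::] W i) j.
Let G j k := qsum r (fun i => qmul n (pf i) (qmul n (Wf i j) (Wf i k))).
Let qf j := qsum c (fun k => qabs n (G j k)).
Let val := qsum r (fun i => qsum c (fun j => if ent B i j then qmul n (pf i) (Wf i j) else (0, 0))).
Let P := qsum r pf.
Let Q := qsum c qf.

Definition dual_check : bool :=
  [&& 0 <= n, 0 < td, all (fun i => qge0 n (pf i)) (iota 0 r),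
      all (fun j => qgt0 n (qf j)) (iota 0 c),
      all (fun j => all (fun k => qge0 n (qabs n (G j k))) (iota 0 c)) (iota 0 c),
      qgt0 n P, qgt0 n Q, qge0 n val
    & qge0 n (qadd (qmul n (td, 0) (qmul n val val)) (qopp (qmul n t (qmul n P Q))))].

Lemma dual_checkP (R : realType) (x : R) :
    dual_check -> 0 <= x -> Zreal R td * x ^+ 2 = qreal n R t ->
  dual_witness (fun (i : 'I_r) (j : 'I_c) => ent B i j) x.
Proof.
move=> /and5P[n0 td0 /allP p0 /allP q0] /and5P[/allP G0 P0 Q0 v0 vle] x0 xt.
pose ev := qreal n R.
have q0' (j : 'I_c) : 0 < ev (qf j) by apply: qgt0P => //; apply: q0; rewrite in_iota0.
have p0' (i : 'I_r) : 0 <= ev (pf i) by apply: qge0P => //; apply: p0; rewrite in_iota0.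
have PE : \sum_(i < r) ev (pf i) = ev P by rewrite /ev qreal_sum.
have QE : \sum_(j < c) ev (qf j) = ev Q by rewrite /ev qreal_sum.
exists (fun (i : 'I_r) (j : 'I_c) => ev (pf i) * ev (Wf i j)).
exists (fun i : 'I_r => ev (pf i)), (fun j : 'I_c => ev (qf j)).
split.
- by split=> // j; apply: ltW.
- split=> [i j ->|i j qj]; first by rewrite mul0r.
  by move: (q0' j); rewrite qj ltxx.
- by rewrite PE QE; split; apply: qgt0P.
- move=> a b.
  (* With z = W b, the bound 2 a_i z_i <= a_i^2 + z_i^2 reduces the claim to comparing the sum of
     p_i z_i^2, which is the form of [G] at [b], with the sum of q_j b_j^2. *)
  pose z i := \sum_(j < c) ev (Wf i j) * b j.
  apply: (@le_trans _ _ ((\sum_(i < r) ev (pf i) * a i ^+ 2 + \sum_(i < r) ev (pf i) * z i ^+ 2) / 2)).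
    rewrite -big_split mulr_suml /=; apply: ler_sum => i _.
    rewrite (_ : \sum_j _ = ev (pf i) * (a i * z i)); last first.
      by rewrite /z !mulr_sumr; apply: eq_bigr => j _; ring.
    by rewrite -mulrDr -mulrA ler_wpM2l//; have := sqr_ge0 (a i - z i); nra.
  rewrite ler_pM2r ?invr_gt0// lerD2l.
  pose g j k := ev (G j k).
  have -> : \sum_(i < r) ev (pf i) * z i ^+ 2 = \sum_(j < c) \sum_(k < c) g j k * (b j * b k).
    transitivity (\sum_(i < r) \sum_(j < c) \sum_(k < c) ev (pf i) * (ev (Wf i j) * ev (Wf i k)) * (b j * b k)).
      apply: eq_bigr => i _; rewrite expr2 {1}/z mulr_suml mulr_sumr; apply: eq_bigr => j _.
      by rewrite /z !mulr_sumr; apply: eq_bigr => k _; ring.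
    rewrite exchange_big; apply: eq_bigr => j _; rewrite exchange_big; apply: eq_bigr => k _.
    rewrite -mulr_suml /g /G /ev qreal_sum; congr (_ * _).
    by apply: eq_bigr => i _; rewrite !qrealM.
  have gC j k : g j k = g k j.
    by rewrite /g /ev !qreal_sum; apply: eq_bigr => i _; rewrite !qrealM// [X in _ * X]mulrC.
  (* Diagonal dominance: |b_j b_k| is at most the mean of b_j^2 and b_k^2, and the symmetry of [g]
     allows both squares to be charged to index j. *)
  apply: (@le_trans _ _ (\sum_(j < c) \sum_(k < c) `|g j k| * b j ^+ 2)).
    have E : \sum_(j < c) \sum_(k < c) `|g j k| * b j ^+ 2 =
             \sum_(j < c) \sum_(k < c) `|g j k| * ((b j ^+ 2 + b k ^+ 2) / 2).
      have E2 : \sum_(j < c) \sum_(k < c) `|g j k| * b j ^+ 2 = \sum_(j < c) \sum_(k < c) `|g j k| * b k ^+ 2.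
        by rewrite exchange_big; apply: eq_bigr => j _; apply: eq_bigr => k _; rewrite gC.
      have -> : \sum_(j < c) \sum_(k < c) `|g j k| * ((b j ^+ 2 + b k ^+ 2) / 2) =
         (\sum_(j < c) \sum_(k < c) `|g j k| * b j ^+ 2 + \sum_(j < c) \sum_(k < c) `|g j k| * b k ^+ 2) / 2.
        rewrite -big_split mulr_suml; apply: eq_bigr => j _ /=.
        by rewrite -big_split mulr_suml; apply: eq_bigr => k _ /=; ring.
      by rewrite -E2; lra.
    rewrite E; apply: ler_sum => j _; apply: ler_sum => k _.
    apply: le_trans (ler_norm _) _; rewrite normrM ler_wpM2l// ler_norml.
    by have := sqr_ge0 (b j - b k); have := sqr_ge0 (b j + b k) => ? ?; apply/andP; split; nra.
  apply: ler_sum => j _; rewrite -mulr_suml ler_wpM2r ?sqr_ge0// /qf /ev qreal_sum.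
  apply: ler_sum => k _; apply: qabsP => //.
  have := G0 j; rewrite in_iota0 => /(_ (ltn_ord j))/allP /(_ k).
  by rewrite in_iota0; apply.
- rewrite PE QE.
  have -> : \sum_(i < r) \sum_(j < c) (ent B i j)%:R * (ev (pf i) * ev (Wf i j)) = ev val.
    rewrite /ev qreal_sum; apply: eq_bigr => i _; rewrite qreal_sum; apply: eq_bigr => j _.
    by case: ent; rewrite ?mul1r ?mul0r ?qrealM ?qreal0.
  have evP : 0 < ev P := qgt0P R n0 P0; have evQ : 0 < ev Q := qgt0P R n0 Q0.
  (* Squaring turns the bound into one between quadratic integers, which the last test of
     [dual_check] decides. *)
  rewrite -(sqrtrM _ (ltW evP)) -ler_sqr ?nnegrE ?mulr_ge0 ?sqrtr_ge0//; last exact: qge0P.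
  rewrite exprMn sqr_sqrtr ?mulr_ge0 ?(ltW evP) ?(ltW evQ)// -(ler_pM2l (Zreal_gt0 R td0)) mulrA xt.
  by have := qle R n0 vle; rewrite !qrealM// qrealZ expr2.
Qed.

End DualCheck.

(* The certified value is [sqrt (mu * nu) / lam], after rescaling [u] against [v]. *)
Section FactorCheck.
Variables (n : Z) (B : pattern) (d : seq Zpair) (u v : seq (seq Zpair)).
Variables (mu nu : Zpair) (lam : Z) (t : Zpair) (td : Z).
Let r := nrow B.
Let c := ncol B.
Let df k : Zpair := nth (0, 0) d k.
Let uf i k : Zpair := nth (0, 0) (nth [::] u i) k.
Let vf j k : Zpair := nth (0, 0) (nth [::] v j) k.
Let dot (x y : nat -> Zpair) := qsum (size d) (fun k => qmul n (df k) (qmul n (x k) (y k))).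
Let qleb x y := qge0 n (qadd y (qopp x)).

Definition factor_check : bool :=
  [&& [&& wf B, 0 <= n, 0 < td & 0 < lam], all (fun k => qge0 n (df k)) (iota 0 (size d)),
      all (fun i => all (fun j => dot (uf i) (vf j) == if ent B i j then (lam, 0) else (0, 0)) (iota 0 c)) (iota 0 r),
      all (fun i => qleb (dot (uf i) (uf i)) mu) (iota 0 r),
      all (fun j => qleb (dot (vf j) (vf j)) nu) (iota 0 c),
      qgt0 n mu
    & qleb (qmul n (td, 0) (qmul n mu nu)) (qmul n t (lam * lam, 0))].

Lemma factor_checkP (R : realType) (x : R) :
    factor_check -> 0 < x -> Zreal R td * x ^+ 2 = qreal n R t ->
  factors (ent B) x.
Proof.
move=> /and5P[/and4P[Bw n0 td0 lam0] /allP d0 /allP uv /allP um].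
move=> /and3P[/allP vn mu0 le] x0 xt.
pose ev := qreal n R.
have m0 : 0 < ev mu by apply: qgt0P.
have l0 : 0 < Zreal R lam by apply: Zreal_gt0.
have t0 : 0 < Zreal R td by apply: Zreal_gt0.
have dotE y z : ev (dot y z) = \sum_(k < size d) ev (df k) * (ev (y k) * ev (z k)).
  by rewrite /ev qreal_sum; apply: eq_bigr => k _; rewrite !qrealM.
(* Multiplying [d] by x / mu makes the row bound [x]. Multiplying [v] by mu / (x lam) makes the
   products 0 or 1 and the column bound mu nu / (x lam^2), which is at most [x] because mu nu <= x^2
   lam^2. *)
exists 'I_(size d), (fun k : 'I_(size d) => ev (df k) * (x / ev mu)).
exists (fun i (k : 'I_(size d)) => if (i < r)%N then ev (uf i k) else 0).
exists (fun j (k : 'I_(size d)) => if (j < c)%N then ev (vf j k) * (ev mu / (x * Zreal R lam)) else 0).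
split.
- move=> k; rewrite mulr_ge0 ?divr_ge0 ?(ltW x0) ?(ltW m0)//.
  by apply: qge0P => //; apply: d0; rewrite in_iota0.
- move=> i j; case: ltnP => [ir|ir]; last first.
    by rewrite ent_row_out// big1// => k _; rewrite mul0r mulr0.
  case: ltnP => [jc|jc]; last first.
    by rewrite ent_col_out// big1// => k _; rewrite !mulr0.
  have := uv i; rewrite in_iota0 => /(_ ir) /allP /(_ j); rewrite in_iota0 => /(_ jc) /eqP.
  move/(congr1 ev); rewrite dotE => E.
  transitivity ((\sum_(k < size d) ev (df k) * (ev (uf i k) * ev (vf j k))) / Zreal R lam).
    by rewrite mulr_suml; apply: eq_bigr => k _; field; rewrite !gt_eqF.
  rewrite E; case: ent; first by rewrite /ev qrealZ mulfV// gt_eqF.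
  by rewrite /ev qreal0 mul0r.
- move=> i; case: ltnP => [ir|_]; last first.
    by rewrite big1 ?ltW// => k _; rewrite expr0n mulr0.
  have := um i; rewrite in_iota0 => /(_ ir) /(qle R n0); rewrite -/ev dotE => E.
  rewrite (_ : \sum_k _ = (\sum_(k < size d) ev (df k) * (ev (uf i k) * ev (uf i k))) * (x / ev mu)).
    by rewrite mulrA ler_pdivrMr// mulrC ler_pM2l.
  by rewrite mulr_suml; apply: eq_bigr => k _; ring.
- move=> j; case: ltnP => [jc|_]; last first.
    by rewrite big1 ?ltW// => k _; rewrite expr0n mulr0.
  have := vn j; rewrite in_iota0 => /(_ jc) /(qle R n0); rewrite -/ev dotE => E.
  rewrite (_ : \sum_k _ = (\sum_(k < size d) ev (df k) * (ev (vf j k) * ev (vf j k))) * (ev mu / (x * Zreal R lam ^+ 2))); last first.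
    by rewrite mulr_suml; apply: eq_bigr => k _; field; rewrite !gt_eqF.
  rewrite mulrA ler_pdivrMr ?mulr_gt0 ?exprn_gt0//.
  apply: (@le_trans _ _ (ev mu * ev nu)); first by rewrite mulrC ler_pM2l.
  rewrite -(ler_pM2l t0); have := qle R n0 le; rewrite !qrealM// !qrealZ ZrealM -xt.
  by move/le_trans; apply; rewrite le_eqVlt; apply/orP; left; apply/eqP; ring.
Qed.

End FactorCheck.

(** * Occurrences of patterns *)

Definition mkpat (r c : nat) (f : nat -> nat -> bool) : pattern :=
  [seq [seq f i j | j <- iota 0 c] | i <- iota 0 r].
Definition transp (B : pattern) : pattern :=
  mkpat (ncol B) (nrow B) (fun i j => ent B j i).

Lemma nrow_mkpat r c f : nrow (mkpat r c f) = r.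
Proof. by rewrite /nrow size_map size_iota. Qed.

Lemma ncol_mkpat r c f : (0 < r)%N -> ncol (mkpat r c f) = c.
Proof. by case: r => // r _; rewrite /ncol /= size_map size_iota. Qed.

Lemma ent_mkpat r c f i j : (i < r)%N -> (j < c)%N -> ent (mkpat r c f) i j = f i j.
Proof.
move=> ir jc; rewrite /ent (nth_map 0%N) ?size_iota// (nth_map 0%N) ?size_iota//.
by rewrite !nth_iota// !add0n.
Qed.

(* [f] and [g] need not be injective: dual witnesses push forward along any maps. *)
Definition occurs (I J : Type) (B : pattern) (A : I -> J -> bool) : Prop :=
  exists (f : nat -> I) (g : nat -> J), forall i j,
    (i < nrow B)%N -> (j < ncol B)%N -> A (f i) (g j) = ent B i j.

(* [cands] lists, for each column of [B], the columns of [M] that still match it. *)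
Fixpoint search (M B : pattern) (cands : seq (seq nat)) : bool :=
  if B is b :: B' then
    has (fun r =>
      let cands' := [seq [seq y <- p.2 | nth false r y == p.1] | p <- zip b cands] in
      all (fun l => l != [::]) cands' && search M B' cands') M
  else all (fun l => l != [::]) cands.

Definition contains (B M : pattern) : bool :=
  search M B (nseq (ncol B) (iota 0 (ncol M))).

(** Columns are chosen only after all rows: a surviving candidate agrees with every chosen row, and
    different columns choose independently. *)
Lemma searchP (M B : pattern) w cands :
    search M B cands -> size cands = w -> all (fun r => size r == w) B ->
  exists2 f : nat -> nat, (forall i, (i < nrow B)%N -> (f i < nrow M)%N)
    & forall j, (j < w)%N -> exists2 y, y \in nth [::] cands j
      & forall i, (i < nrow B)%N -> ent M (f i) y = ent B i j.
Proof.
elim: B cands => [|b B IH] cands /=.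
  move=> /allP ne <- _; exists id => // j jw.
  have := ne _ (mem_nth [::] jw); case E: (nth [::] cands j) => [|y l] // _.
  by exists y => //; rewrite mem_head.
move=> /hasP[r rM /andP[_ sr]] cw /andP[/eqP bw Bw].
have [|f fM fP] := IH _ sr _ Bw; first by rewrite size_map size_zip bw cw minnn.
exists (fun i => if i is i'.+1 then f i' else index r M).
  by case=> [|i] ib; [rewrite /nrow index_mem|apply: fM].
move=> j jw; have [y yj yP] := fP j jw.
move: yj; rewrite (nth_map (false, [::])) ?size_zip ?bw ?cw ?minnn//.
rewrite nth_zip ?bw ?cw//= mem_filter => /andP[/eqP ry yc].
exists y => // -[|i] ib; last exact: yP.
by rewrite /ent nth_index.
Qed.

Lemma occurs_contains (I J : Type) (A : I -> J -> bool) (B M : pattern) :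
  wf B -> contains B M -> occurs M A -> occurs B A.
Proof.
move=> Bw /searchP sP [f [g fg]].
have [|//|F FM FP] := sP (ncol B); first by rewrite size_nseq.
have /choice[G GP] : forall j, exists y, (j < ncol B)%N -> (y < ncol M)%N /\
    forall i, (i < nrow B)%N -> ent M (F i) y = ent B i j.
  move=> j; have [jB|jB] := ltnP j (ncol B); last by exists 0%N.
  have [y] := FP j jB; rewrite nth_nseq jB in_iota0 => yM yP.
  by exists y.
exists (f \o F), (g \o G) => i j ir jc /=.
have [GM GE] := GP j jc.
by rewrite fg ?GE// FM.
Qed.

Lemma occurs_ent (B : pattern) : occurs B (ent B).
Proof. by exists id, id. Qed.

Lemma occurs_transp (I J : Type) (A : I -> J -> bool) (B : pattern) :
  (0 < ncol B)%N -> occurs (transp B) A -> occurs B (fun j i => A i j).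
Proof.
move=> c0 [f [g fg]]; exists g, f => i j ir jc.
by rewrite fg ?ent_mkpat ?nrow_mkpat ?ncol_mkpat.
Qed.

Lemma factors_occurs (R : realType) (I J : Type) (A : I -> J -> bool) (B : pattern) (c : R) :
  0 <= c -> wf B -> occurs B A -> factors A c -> factors (ent B) c.
Proof.
move=> c0 Bw [f [g fg]] [K [d [u [v [d0 uv uc vc]]]]].
exists K, d, (fun i k => if (i < nrow B)%N then u (f i) k else 0).
exists (fun j k => if (j < ncol B)%N then v (g j) k else 0); split=> // [i j|i|j].
- case: ltnP => ir; last by rewrite ent_row_out// big1// => k _; rewrite mul0r mulr0.
  case: ltnP => jc; last by rewrite ent_col_out// big1// => k _; rewrite !mulr0.
  by rewrite uv fg.
- case: ltnP => // _; rewrite big1// => k _; by rewrite expr0n mulr0.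
- case: ltnP => // _; rewrite big1// => k _; by rewrite expr0n mulr0.
Qed.

Lemma occurs_dual_witness (R : realType) (I J : finType) (A : I -> J -> bool) (B : pattern) (c : R) :
    dual_witness (fun (i : 'I_(nrow B)) (j : 'I_(ncol B)) => ent B i j) c ->
  occurs B A -> dual_witness A c.
Proof.
move=> dB [f [g fg]].
by apply: (dual_witness_sub (f := f \o val) (g := g \o val)) dB => i j /=; rewrite fg.
Qed.

(** * Occurrences that extend only by twins *)

Section MaximalOccurrence.

Fixpoint all_bools (c : nat) : seq (seq bool) :=
  if c is c'.+1 then [seq b :: t | b <- [:: true; false], t <- all_bools c'] else [:: [::]].

Lemma mem_all_bools t : t \in all_bools (size t).
Proof.
elim: t => //= b t IH; rewrite !mem_cat.
by case: b; rewrite map_f ?orbT.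
Qed.

Variables (forb : seq pattern) (M : pattern).
Let r := nrow M.
Let c := ncol M.

Definition escapes (E : pattern) : bool := has (fun B => contains B E) forb.
Definition row_ext (t : seq bool) : pattern :=
  mkpat r.+1 c (fun i j => if (i < r)%N then ent M i j else nth false t j).
Definition col_ext (t : seq bool) : pattern :=
  mkpat r c.+1 (fun i j => if (j < c)%N then ent M i j else nth false t i).
(* Duplicates row [i0] and column [j0] of [M] ([i0 = r] or [j0 = c] stands for a zero row or column)
   and puts the wrong value at the new corner. *)
Definition twin_ext (i0 j0 : nat) : pattern :=
  mkpat r.+1 c.+1 (fun i j =>
    if (i == r) && (j == c) then ~~ ent M i0 j0
    else ent M (if i == r then i0 else i) (if j == c then j0 else j)).

(** The ranges up to [r] and [c] inclusive admit the zero row and column, that is, vertices with no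
    neighbour in [M]. Two such vertices may or may not be adjacent, hence the exempted pair (r,
    c). *)
Definition maximal_check : bool :=
  [&& (0 < r)%N, (0 < c)%N,
      all (fun t => has (fun i => t == [seq ent M i j | j <- iota 0 c]) (iota 0 r.+1)
                    || escapes (row_ext t)) (all_bools c),
      all (fun t => has (fun j => t == [seq ent M i j | i <- iota 0 r]) (iota 0 c.+1)
                    || escapes (col_ext t)) (all_bools r)
    & all (fun i => all (fun j => (i == r) && (j == c) || escapes (twin_ext i j)) (iota 0 c.+1))
          (iota 0 r.+1)].

Variables (I J : Type) (A : I -> J -> bool).
Hypothesis forb_wf : all wf forb.
Hypothesis forb_A : forall B, B \in forb -> ~ occurs B A.

Let no_escape E : occurs E A -> escapes E = false.
Proof.
move=> oE; apply/negP => /hasP[B BF cB].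
by apply: (forb_A BF); apply: occurs_contains cB oE; apply: (allP forb_wf).
Qed.

(** [rho] and [sig] send a vertex to the one of [M] that it duplicates, or to [r], [c] if it has no
    neighbour in the occurrence; any other behaviour would produce a forbidden one-vertex extension.
    A wrong entry at (x, y) would make a forbidden [twin_ext] occur. *)
Lemma maximal_blowup f g :
    (forall i j, (i < r)%N -> (j < c)%N -> A (f i) (g j) = ent M i j) ->
    maximal_check ->
  exists (rho : I -> nat) (sig : J -> nat),
    (forall x j, (j < c)%N -> A x (g j) = ent M (rho x) j) /\
    (forall x y, (rho x < r)%N || (sig y < c)%N -> A x y = ent M (rho x) (sig y)).
Proof.
move=> fg /and5P[r0 c0 /allP rowP /allP colP /allP twinP].
have /choice[rho rhoP] : forall x, exists i, (i <= r)%N /\ forall j, (j < c)%N -> A x (g j) = ent M i j.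
  move=> x; pose t := [seq A x (g j) | j <- iota 0 c].
  have tE j : (j < c)%N -> nth false t j = A x (g j).
    by move=> jc; rewrite (nth_map 0%N) ?size_iota// nth_iota.
  have tin : t \in all_bools c.
    by have := mem_all_bools t; rewrite size_map size_iota.
  have /orP[/hasP[k]|] := rowP _ tin.
    rewrite in_iota0 ltnS => kr /eqP tk; exists k; split=> // j jc.
    by rewrite -tE// tk (nth_map 0%N) ?size_iota// nth_iota.
  rewrite no_escape//; exists (fun i => if (i < r)%N then f i else x), g => i j.
  rewrite nrow_mkpat ncol_mkpat// => ir jc; rewrite ent_mkpat//.
  by case: ifP => i_r; rewrite ?fg ?tE.
have /choice[sig sigP] : forall y, exists j, (j <= c)%N /\ forall i, (i < r)%N -> A (f i) y = ent M i j.
  move=> y; pose t := [seq A (f i) y | i <- iota 0 r].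
  have tE i : (i < r)%N -> nth false t i = A (f i) y.
    by move=> ir; rewrite (nth_map 0%N) ?size_iota// nth_iota.
  have tin : t \in all_bools r.
    by have := mem_all_bools t; rewrite size_map size_iota.
  have /orP[/hasP[j]|] := colP _ tin.
    rewrite in_iota0 ltnS => jc /eqP tj; exists j; split=> // i ir.
    by rewrite -tE// tj (nth_map 0%N) ?size_iota// nth_iota.
  rewrite no_escape//; exists f, (fun j => if (j < c)%N then g j else y) => i j.
  rewrite nrow_mkpat ncol_mkpat// => ir jc; rewrite ent_mkpat//.
  by case: ifP => j_c; rewrite ?fg ?tE.
exists rho, sig; split=> [x j jc|x y xy]; first by have [_ ->] := rhoP x.
have [rx rxE] := rhoP x; have [sy syE] := sigP y.
apply/eqP; apply: contraT => Axy.
have := twinP (rho x); rewrite in_iota0 ltnS => /(_ rx) /allP /(_ (sig y)).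
rewrite in_iota0 ltnS => /(_ sy) /orP[/andP[/eqP xr /eqP yc]|].
  by move: xy; rewrite xr yc !ltnn.
rewrite no_escape//.
exists (fun i => if i == r then x else f i), (fun j => if j == c then y else g j) => i j.
rewrite nrow_mkpat ncol_mkpat// !ltnS => ir jc; rewrite ent_mkpat ?ltnS//.
case: eqP => [_|/eqP in_r]; case: eqP => [_|/eqP jn_c] //=.
- by move: Axy; case: (A x y); case: ent.
- by rewrite rxE// ltn_neqAle jn_c.
- by rewrite syE// ltn_neqAle in_r.
- by rewrite fg// ltn_neqAle ?in_r ?jn_c.
Qed.

End MaximalOccurrence.

(** * Splitting off a blow-up *)

Definition no_zero_row (B : pattern) : bool :=
  all (fun i => has (fun j => ent B i j) (iota 0 (ncol B))) (iota 0 (nrow B)).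

Section Peeling.
Variables (R : realType) (I J : Type) (A : I -> J -> bool) (M : pattern).
Variables (rho : I -> nat) (sig : J -> nat).
Let r := nrow M.
Let c := ncol M.
Hypothesis M_wf : wf M.
Hypothesis blowup : forall x y, (rho x < r)%N || (sig y < c)%N -> A x y = ent M (rho x) (sig y).

(** By [blowup], rows with [rho x < r] are adjacent only to columns with [sig y < c], and
    conversely. So this erases the blow-up of [M] and leaves the other components whole. *)
Definition peel x y : bool := A x y && (r <= rho x)%N.

(** The direct sum of the two factorizations. Each vertex has a nonzero vector in at most one
    summand, so the bound [e] does not grow. *)
Lemma factors_peel (e : R) : factors (ent M) e -> factors peel e -> factors A e.
Proof.
move=> [K [d [u [v [d0 uv uc vc]]]]] [K' [d' [u' [v' [d0' uv' uc' vc']]]]].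
have e0 : forall x : I, 0 <= e.
  move=> x; apply: le_trans (uc (rho x)); apply: sumr_ge0 => k _.
  by rewrite mulr_ge0 ?sqr_ge0.
have e0' : forall y : J, 0 <= e.
  move=> y; apply: le_trans (vc (sig y)); apply: sumr_ge0 => k _.
  by rewrite mulr_ge0 ?sqr_ge0.
exists (K + K')%type, (fun k => match k with inl k => d k | inr k => d' k end).
exists (fun x k => match k with
  | inl k => if (rho x < r)%N then u (rho x) k else 0
  | inr k => if (rho x < r)%N then 0 else u' x k end).
exists (fun y k => match k with
  | inl k => if (sig y < c)%N then v (sig y) k else 0
  | inr k => if (sig y < c)%N then 0 else v' y k end).
have S0 (T : finType) (h w : T -> R) : \sum_k h k * (0 * w k) = 0.
  by rewrite big1// => k _; rewrite mul0r mulr0.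
have S0' (T : finType) (h w : T -> R) : \sum_k h k * (w k * 0) = 0.
  by rewrite big1// => k _; rewrite !mulr0.
have S2 (T : finType) (h : T -> R) : \sum_k h k * 0 ^+ 2 = 0.
  by rewrite big1// => k _; rewrite expr0n mulr0.
split=> [[k|k]//|x y|x|y]; rewrite big_sumType /=.
- case: (ltnP (rho x) r) => xr; case: (ltnP (sig y) c) => yc.
  + by rewrite uv S0 addr0 blowup ?xr.
  + by rewrite S0' S0 addr0 blowup ?xr// ent_col_out.
  + by rewrite S0 S0' addr0 blowup ?yc ?orbT// ent_row_out.
  + by rewrite S0 uv' add0r /peel xr andbT.
- by case: ltnP => _; rewrite S2 ?addr0 ?add0r.
- by case: ltnP => _; rewrite S2 ?addr0 ?add0r.
Qed.

(** Each row of [B] has an edge, so it lands on a row that [peel] has kept, and there [peel] and [A]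
    agree. *)
Lemma occurs_peel B : no_zero_row B -> occurs B peel -> occurs B A.
Proof.
move=> /allP nz [f [g fg]]; exists f, g => i j ir jc.
have := nz i; rewrite in_iota0 => /(_ ir) /hasP[k]; rewrite in_iota0 => kc Bik.
have := fg i k ir kc; rewrite Bik => /andP[_ rf].
by rewrite -fg// /peel rf andbT.
Qed.

End Peeling.

(** * The small graphs *)

Definition pat : seq (seq nat) -> pattern := map (map (fun b => b != 0)%N).

Definition point : pattern := pat [:: [:: 1]]%N.
Definition path4 : pattern := pat [:: [:: 1; 1]; [:: 0; 1]]%N.
Definition path5 : pattern := pat [:: [:: 1; 1; 0]; [:: 0; 1; 1]]%N.
Definition path6 : pattern := pat [:: [:: 1; 0; 0]; [:: 1; 1; 0]; [:: 0; 1; 1]]%N.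
Definition path7 : pattern := pat [:: [:: 1; 1; 0; 0]; [:: 0; 1; 1; 0]; [:: 0; 0; 1; 1]]%N.
Definition path8 : pattern := pat [:: [:: 1; 0; 0; 0]; [:: 1; 1; 0; 0]; [:: 0; 1; 1; 0]; [:: 0; 0; 1; 1]]%N.
Definition cycle8 : pattern := pat [:: [:: 1; 0; 0; 1]; [:: 1; 1; 0; 0]; [:: 0; 1; 1; 0]; [:: 0; 0; 1; 1]]%N.
Definition spider122 : pattern := pat [:: [:: 1; 1; 1]; [:: 0; 1; 0]; [:: 0; 0; 1]]%N.
Definition spider123 : pattern := pat [:: [:: 1; 1; 1; 0]; [:: 0; 1; 0; 1]; [:: 0; 0; 1; 0]]%N.
Definition spider133 : pattern := pat [:: [:: 1; 1; 1; 0; 0]; [:: 0; 1; 0; 1; 0]; [:: 0; 0; 1; 0; 1]]%N.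
Definition spider222 : pattern := pat [:: [:: 1; 1; 0; 0]; [:: 1; 0; 1; 0]; [:: 1; 0; 0; 1]]%N.

(* Each graph comes with the index of its norm. The order, larger graphs first, matters in
   [tame_check]. *)
Definition tame : seq (pattern * nat) :=
  [:: (cycle8, 3); (spider133, 4); (transp spider133, 4);
      (path7, 3); (transp path7, 3); (spider222, 5); (transp spider222, 5);
      (spider123, 4); (transp spider123, 4);
      (path6, 3); (spider122, 4); (transp spider122, 4);
      (path5, 2); (transp path5, 2); (path4, 2); (point, 1)]%N.

Section Tables.
Local Open Scope Z_scope.

(* The triple [(n, t, td)] encodes [eta_k ^ 2 = t / td], with the pair [t = (a, b)] standing for
   [a + b sqrt n]. *)
Definition eta_sq (k : nat) : Z * Zpair * Z :=
  match k with
  | 1%N => (0, (1, 0), 1)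
  | 2%N => (0, (4, 0), 3)
  | 3%N => (2, (3, 2), 4)
  | 4%N => (19, (169, 38), 225)
  | 5%N => (0, (3, 0), 2)
  | _ => (5, (20, 8), 25)
  end.

Record factor_data := FactorData {
  fd_pat : pattern; fd_d : seq Zpair; fd_u : seq (seq Zpair); fd_v : seq (seq Zpair);
  fd_mu : Zpair; fd_nu : Zpair; fd_lam : Z }.

Definition dual_data := (pattern * seq Zpair * seq (seq Zpair))%type.
Definition DualData (B : pattern) (p : seq Zpair) (W : seq (seq Zpair)) : dual_data := (B, p, W).
Definition dd_pat (x : dual_data) : pattern := x.1.1.
Definition dd_p (x : dual_data) : seq Zpair := x.1.2.
Definition dd_W (x : dual_data) : seq (seq Zpair) := x.2.

(* The vectors come from the Cholesky decomposition [u diag(d) u^T] of the Gram matrix of the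
   rows in an optimal factorization; for the 8-cycle they are Fourier modes. *)
Definition host (k : nat) : factor_data :=
  match k with
  | 1%N => FactorData point [:: (1, 0)]
      [:: [:: (1, 0)]]
      [:: [:: (1, 0)]]
      (1, 0) (1, 0) 1
  | 2%N => FactorData path5 [:: (4, 0); (3, 0)]
      [:: [:: (2, 0); (0, 0)]; [:: (1, 0); (2, 0)]]
      [:: [:: (3, 0); (-2, 0)]; [:: (3, 0); (2, 0)]; [:: (0, 0); (4, 0)]]
      (16, 0) (48, 0) 24
  | 3%N => FactorData cycle8 [:: (1, 0); (0, 1); (0, 1)]
      [:: [:: (1, 0); (1, 0); (0, 0)]; [:: (1, 0); (0, 0); (1, 0)]; [:: (1, 0); (-1, 0); (0, 0)]; [:: (1, 0); (0, 0); (-1, 0)]]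
      [:: [:: (2, 0); (0, 1); (0, 1)]; [:: (2, 0); (0, -1); (0, 1)]; [:: (2, 0); (0, -1); (0, -1)]; [:: (2, 0); (0, 1); (0, -1)]]
      (1, 1) (4, 4) 4
  | 4%N => FactorData spider133 [:: (18, 0); (-612, 144); (83, -16)]
      [:: [:: (6, 0); (0, 0); (0, 0)]; [:: (-24, 6); (6, 0); (0, 0)]; [:: (-24, 6); (2, -1); (6, 0)]]
      [:: [:: (450, 0); (-120, -15); (-166, -32)]; [:: (450, 0); (135, 45); (-74, 2)]; [:: (450, 0); (-120, -15); (166, 32)]; [:: (0, 0); (255, 60); (92, 34)]; [:: (0, 0); (0, 0); (332, 64)]]
      (648, 0) (2737800, 615600) 48600
  | 5%N => FactorData spider222 [:: (12, 0); (9, 0); (8, 0)]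
      [:: [:: (6, 0); (0, 0); (0, 0)]; [:: (3, 0); (6, 0); (0, 0)]; [:: (3, 0); (2, 0); (6, 0)]]
      [:: [:: (6, 0); (4, 0); (3, 0)]; [:: (6, 0); (-4, 0); (-3, 0)]; [:: (0, 0); (8, 0); (-3, 0)]; [:: (0, 0); (0, 0); (9, 0)]]
      (432, 0) (648, 0) 432
  | _ => FactorData path8 [:: (8, 0); (-20, 12); (-5, 5); (50, -20)]
      [:: [:: (4, 0); (0, 0); (0, 0); (0, 0)]; [:: (6, -2); (4, 0); (0, 0); (0, 0)]; [:: (4, -2); (2, 0); (4, 0); (0, 0)]; [:: (-4, 2); (-3, 1); (-2, 2); (4, 0)]]
      [:: [:: (50, 0); (25, 5); (10, -10); (0, 4)]; [:: (0, 0); (25, 15); (10, 10); (0, -4)]; [:: (0, 0); (0, 0); (20, 20); (20, 4)]; [:: (0, 0); (0, 0); (0, 0); (40, 16)]]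
      (128, 0) (16000, 6400) 1600
  end.

Definition witness (k : nat) : dual_data :=
  match k with
  | 1%N => DualData point [:: (1, 0)]
      [:: [:: (1, 0)]]
  | 2%N => DualData path4 [:: (2, 0); (1, 0)]
      [:: [:: (1, 0); (1, 0)]; [:: (-1, 0); (2, 0)]]
  | 3%N => DualData path6 [:: (2, -1); (2, 0); (0, 1)]
      [:: [:: (1, 1); (0, -1); (1, 0)]; [:: (1, 0); (0, 1); (1, -1)]; [:: (1, -1); (0, 1); (1, 0)]]
  | 4%N => DualData spider122 [:: (4, 0); (23, -5); (23, -5)]
      [:: [:: (27, -6); (-12, 3); (-12, 3)]; [:: (-10, 2); (3, 0); (-5, 1)]; [:: (-10, 2); (-5, 1); (3, 0)]]
  | 5%N => DualData (transp spider222) [:: (5, 0); (1, 0); (1, 0); (1, 0)]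
      [:: [:: (1, 0); (1, 0); (1, 0)]; [:: (3, 0); (-1, 0); (-1, 0)]; [:: (-1, 0); (3, 0); (-1, 0)]; [:: (-1, 0); (-1, 0); (3, 0)]]
  | _ => DualData path8 [:: (3, -1); (1, 1); (4, 0); (2, 0)]
      [:: [:: (2, 0); (1, -1); (1, 0); (-3, 1)]; [:: (3, -1); (-1, 1); (4, -2); (-2, 1)]; [:: (2, -1); (1, 0); (1, 0); (2, -1)]; [:: (-2, 1); (4, -2); (-1, 1); (3, -1)]]
  end.

(* Only [path8] has norm exactly [eta_6]; the other norms are larger, so that rounded
   numerical optimizers suffice. *)
Definition forbidden_data : seq dual_data :=
  [:: witness 6;
      DualData (pat [:: [:: 0; 1; 1]; [:: 1; 0; 1]; [:: 1; 1; 0]]%N) [:: (1, 0); (1, 0); (1, 0)]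
      [:: [:: (-1, 0); (2, 0); (2, 0)]; [:: (2, 0); (-1, 0); (2, 0)]; [:: (2, 0); (2, 0); (-1, 0)]];
      DualData (pat [:: [:: 0; 0; 1]; [:: 0; 1; 1]; [:: 1; 1; 1]]%N) [:: (6, 0); (8, 0); (15, 0)]
      [:: [:: (-4, 0); (-21, 0); (38, 0)]; [:: (-15, 0); (21, 0); (17, 0)]; [:: (15, 0); (9, 0); (13, 0)]];
      DualData (pat [:: [:: 0; 1; 1]; [:: 1; 0; 1]; [:: 1; 1; 1]]%N) [:: (3, 0); (3, 0); (5, 0)]
      [:: [:: (-7, 0); (5, 0); (10, 0)]; [:: (5, 0); (-7, 0); (10, 0)]; [:: (7, 0); (7, 0); (2, 0)]];
      DualData (pat [:: [:: 0; 0; 0; 1]; [:: 0; 0; 1; 0]; [:: 0; 1; 0; 1]; [:: 1; 0; 1; 1]]%N) [:: (5, 0); (4, 0); (11, 0); (20, 0)]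
      [:: [:: (-19, 0); (-21, 0); (-10, 0); (50, 0)]; [:: (-24, 0); (4, 0); (50, 0); (-10, 0)]; [:: (-5, 0); (21, 0); (-6, 0); (29, 0)]; [:: (13, 0); (-2, 0); (16, 0); (21, 0)]];
      DualData (pat [:: [:: 0; 0; 0; 1]; [:: 0; 0; 1; 1]; [:: 0; 1; 1; 0]; [:: 1; 0; 1; 0]]%N) [:: (1, 0); (5, 0); (4, 0); (4, 0)]
      [:: [:: (9, 0); (9, 0); (-11, 0); (19, 0)]; [:: (-3, 0); (-3, 0); (11, 0); (7, 0)]; [:: (-2, 0); (8, 0); (11, 0); (-2, 0)]; [:: (8, 0); (-2, 0); (11, 0); (-2, 0)]];
      DualData (pat [:: [:: 0; 0; 0; 1]; [:: 0; 0; 1; 1]; [:: 0; 1; 0; 1]; [:: 1; 0; 0; 1]]%N) [:: (1, 0); (3, 0); (3, 0); (3, 0)]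
      [:: [:: (-6, 0); (-6, 0); (-6, 0); (13, 0)]; [:: (-1, 0); (-1, 0); (6, 0); (7, 0)]; [:: (-1, 0); (6, 0); (-1, 0); (7, 0)]; [:: (6, 0); (-1, 0); (-1, 0); (7, 0)]];
      DualData (pat [:: [:: 0; 0; 0; 1]; [:: 0; 0; 1; 1]; [:: 0; 1; 0; 1]; [:: 1; 0; 1; 0]]%N) [:: (11, 0); (42, 0); (27, 0); (20, 0)]
      [:: [:: (40, 0); (-54, 0); (-64, 0); (124, 0)]; [:: (-16, 0); (-9, 0); (64, 0); (60, 0)]; [:: (5, 0); (54, 0); (-19, 0); (70, 0)]; [:: (52, 0); (10, 0); (72, 0); (-24, 0)]]].

End Tables.

Definition forbidden : seq pattern :=
  [seq dd_pat x | x <- forbidden_data] ++ [seq transp (dd_pat x) | x <- forbidden_data].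

Definition check_dual (k : nat) (x : dual_data) : bool :=
  let: (n, t, td) := eta_sq k in
  (0 < ncol (dd_pat x))%N && dual_check n (dd_pat x) (dd_p x) (dd_W x) t td.
Definition check_factor (k : nat) (x : factor_data) : bool :=
  let: (n, t, td) := eta_sq k in
  factor_check n (fd_pat x) (fd_d x) (fd_u x) (fd_v x) (fd_mu x) (fd_nu x) (fd_lam x) t td.

Lemma host_ok : all (fun k => check_factor k (host k)) (iota 1 6).
Proof. by vm_compute. Qed.

Lemma witness_ok : all (fun k => check_dual k (witness k)) (iota 1 6).
Proof. by vm_compute. Qed.

Lemma forbidden_ok : all (check_dual 6) forbidden_data.
Proof. by vm_compute. Qed.

(** Occurring in the host gives the upper bound [eta k], containing the witness gives the lower one.
    Maximality is relative to the forbidden graphs and to the entries of [tame] before [q]. *)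
Definition tame_check (q : nat) : bool :=
  let: (M, k) := nth (point, 1%N) tame q in
  let W := dd_pat (witness k) in
  let H := fd_pat (host k) in
  [&& (0 < k <= 5)%N && wf M,
      contains M H || contains M (transp H), contains W M || contains (transp W) M
    & maximal_check (forbidden ++ take q (unzip1 tame)) M].

Lemma tame_ok : all tame_check (iota 0 (size tame)).
Proof. by vm_compute. Qed.

Lemma patterns_ok : all wf (forbidden ++ unzip1 tame) && all no_zero_row (forbidden ++ unzip1 tame).
Proof. by vm_compute. Qed.

(** The size bound places each witness inside the 5 by 5 corner. Having no zero row in either
    orientation lets its occurrences pass from a peeled matrix to the whole one. *)
Lemma witness_patterns_ok : all (fun k => let W := dd_pat (witness k) in let H := fd_pat (host k) in
  [&& wf W, wf (transp W), no_zero_row W, no_zero_row (transp W), (nrow W <= 5)%N, (ncol W <= 5)%N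
    & contains W H || contains W (transp H)]) (iota 1 6).
Proof. by vm_compute. Qed.

(** * Squares and order of the values eta_k *)

Section EtaValues.
Variable R : realType.
Local Notation eta := (@schur_eta R).

Let ZrealE z (m : nat) : int_of_Z z = m%:Z -> Zreal R z = m%:R.
Proof. by rewrite /Zreal => ->. Qed.

Lemma schur_eta_sq k : (0 < k <= 6)%N ->
  Zreal R (eta_sq k).2 * eta k ^+ 2 = qreal (eta_sq k).1.1 R (eta_sq k).1.2.
Proof.
have s2 : Num.sqrt 2 ^+ 2 = 2 :> R by rewrite sqr_sqrtr.
have s5 : 0 <= Num.sqrt 5 :> R by rewrite sqrtr_ge0.
have s19 : 0 <= Num.sqrt 19 :> R by rewrite sqrtr_ge0.
have z0 := @ZrealE 0 0 erefl.
rewrite /qreal; case: k => // -[|[|[|[|[|[|//]]]]]] _ /=.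
- by rewrite z0 (@ZrealE 1 1)//; ring.
- by rewrite z0 (@ZrealE 3 3)// (@ZrealE 4 4)// sqr_sqrtr; [field|lra].
- rewrite (@ZrealE 2 2)// (@ZrealE 3 3)// (@ZrealE 4 4)//.
  transitivity (1 + 2 * Num.sqrt 2 + Num.sqrt 2 ^+ 2 :> R); first by field.
  by rewrite s2; ring.
- rewrite (@ZrealE 19 19)// (@ZrealE 169 169)// (@ZrealE 38 38)// (@ZrealE 225 225)//.
  by rewrite exprMn sqr_sqrtr; [field|lra].
- by rewrite z0 (@ZrealE 3 3)// (@ZrealE 2 2)// sqr_sqrtr; [field|lra].
- rewrite (@ZrealE 5 5)// (@ZrealE 20 20)// (@ZrealE 8 8)// (@ZrealE 25 25)//.
  by rewrite exprMn sqr_sqrtr; [field|lra].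
Qed.

Lemma schur_eta_gt0 k : (0 < k)%N -> 0 < eta k.
Proof.
have s5 : 0 <= Num.sqrt 5 :> R by rewrite sqrtr_ge0.
have s19 : 0 <= Num.sqrt 19 :> R by rewrite sqrtr_ge0.
have s2 : 0 <= Num.sqrt 2 :> R by rewrite sqrtr_ge0.
by case: k => // -[|[|[|[|[|k]]]]] _ /=; rewrite ?mulr_gt0 ?sqrtr_gt0//; lra.
Qed.

Lemma schur_eta_ge0 k : 0 <= eta k.
Proof. by case: k => [|k]; rewrite ?lexx// ltW// schur_eta_gt0. Qed.

Lemma schur_eta_le k l : (k <= l <= 5)%N -> eta k <= eta l.
Proof.
have sqle (x y : R) : 0 <= y -> x ^+ 2 <= y ^+ 2 -> x <= y.
  by move=> y0 xy; nra.
have step i : (i < 5)%N -> eta i <= eta i.+1.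
  move=> i5; apply: (sqle); first exact: schur_eta_ge0.
  (* The tightest comparison is eta_3 < eta_4: these bounds put the first square below 1.475 and the
     second above 1.477. *)
  have b2l : 6 / 5 <= Num.sqrt 2 :> R by apply: (sqle); rewrite ?sqrtr_ge0 ?sqr_sqrtr//; lra.
  have b2u : Num.sqrt 2 <= 29 / 20 :> R by apply: (sqle); rewrite ?sqr_sqrtr//; lra.
  have b19l : 43 / 10 <= Num.sqrt 19 :> R by apply: (sqle); rewrite ?sqrtr_ge0 ?sqr_sqrtr//; lra.
  have b19u : Num.sqrt 19 <= 22 / 5 :> R by apply: (sqle); rewrite ?sqr_sqrtr//; lra.
  have e2 : Num.sqrt (4 / 3) ^+ 2 = 4 / 3 :> R by rewrite sqr_sqrtr//; lra.
  have e3 : ((1 + Num.sqrt 2) / 2) ^+ 2 = (3 + 2 * Num.sqrt 2) / 4 :> R.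
    transitivity ((1 + 2 * Num.sqrt 2 + Num.sqrt 2 ^+ 2) / 4 : R); first by field.
    by rewrite sqr_sqrtr//; lra.
  have e4 : (15^-1 * Num.sqrt (169 + 38 * Num.sqrt 19)) ^+ 2 = (169 + 38 * Num.sqrt 19) / 225 :> R.
    by rewrite exprMn sqr_sqrtr; [field|lra].
  have e5 : Num.sqrt (3 / 2) ^+ 2 = 3 / 2 :> R by rewrite sqr_sqrtr//; lra.
  case: i i5 => [|[|[|[|[|//]]]]] _; rewrite /schur_eta.
  - by rewrite expr0n expr1n.
  - by rewrite e2 expr1n; lra.
  - by rewrite e2 e3; lra.
  - by rewrite e3 e4; lra.
  - by rewrite e4 e5; lra.
move=> /andP[kl l5]; elim: l kl l5 => [|l IH] kl l5.
  by move: kl; rewrite leqn0 => /eqP ->.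
move: kl; rewrite leq_eqVlt => /orP[/eqP -> //|kl].
exact: le_trans (IH kl (ltnW l5)) (step _ l5).
Qed.

End EtaValues.

(** * Classification *)

Section Classification.
Variable R : realType.
Local Notation eta := (@schur_eta R).

Lemma factors_host k : (0 < k <= 6)%N -> factors (ent (fd_pat (host k))) (eta k).
Proof.
move=> k6; have /andP[k0 _] := k6.
have := allP host_ok k; rewrite mem_iota add1n ltnS => /(_ k6).
rewrite /check_factor; have := schur_eta_sq R k6; case: (eta_sq k) => [[n t] td] /= e ok.
exact: factor_checkP ok (schur_eta_gt0 R k0) e.
Qed.

Lemma factors_in_host k B : (0 < k <= 6)%N -> wf B ->
    contains B (fd_pat (host k)) || contains B (transp (fd_pat (host k))) ->
  factors (ent B) (eta k).
Proof.
move=> k6 Bw; have fH := factors_host k6; set H := fd_pat _ in fH *.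
have e0 := schur_eta_ge0 R k.
case/orP => cB; first exact: factors_occurs e0 Bw (occurs_contains Bw cB (occurs_ent H)) fH.
have oH : occurs (transp H) (fun j i => ent H i j).
  exists id, id => i j; rewrite nrow_mkpat => ir.
  by rewrite ncol_mkpat ?(leq_trans _ ir)// => jc; rewrite ent_mkpat.
exact: factors_occurs e0 Bw (occurs_contains Bw cB oH) (factors_transpose fH).
Qed.

Lemma check_dualP k x : (0 < k <= 6)%N -> check_dual k x -> forall (I J : finType) (A : I -> J -> bool),
  occurs (dd_pat x) A \/ occurs (transp (dd_pat x)) A -> dual_witness A (eta k).
Proof.
move=> k6; have := schur_eta_sq R k6.
rewrite /check_dual; case: (eta_sq k) => [[n t] td] /= e /andP[c0 ok] I J A.
have dx := dual_checkP ok (schur_eta_ge0 R k) e.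
case=> [|/(occurs_transp c0)] oA; first exact: occurs_dual_witness dx oA.
by have := dual_witness_transpose (occurs_dual_witness dx oA).
Qed.

(** Certifies the lower bound [eta k]; at [k = 0] this is just nonnegativity of the norm. *)
Definition witnessed (k : nat) (I J : Type) (A : I -> J -> bool) : Prop :=
  k = 0%N \/ occurs (dd_pat (witness k)) A \/ occurs (transp (dd_pat (witness k))) A.

(** Induction on the number of edges: the first graph of [tame] that occurs is maximal, its blow-up
    is split off, and the remainder has fewer edges. The larger of the two indices is the answer. *)
Lemma tame_classification (I J : finType) (A : I -> J -> bool) :
    (forall B, B \in forbidden -> ~ occurs B A) ->
  exists k, [/\ (k <= 5)%N, factors A (eta k) & witnessed k A].
Proof.
have [m] := ubnP #|[pred p : I * J | A p.1 p.2]|.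
elim: m A => // m IH A cA noB.
have [[x0 [y0 A0]]|nA] := pselect (exists x y, A x y); last first.
  exists 0%N; split=> //; last by left.
  by apply: factors0 => i j; apply/negP => Aij; apply: nA; exists i, j.
have /andP[/allP pw /allP pz] := patterns_ok.
pose P (B : pattern) := `[< occurs B A >].
have hP : has P (unzip1 tame).
  apply/hasP; exists point; first by vm_compute.
  by apply/asboolP; exists (fun=> x0), (fun=> y0) => -[|i] [|j] //= _ _; rewrite A0.
(* The least such index, so no graph of [take q] occurs; it exists because [point] occurs as soon as
   there is an edge. *)
set q := find P (unzip1 tame).
have qs : (q < size tame)%N by rewrite -(size_map fst) -has_find.
have := allP tame_ok q; rewrite in_iota0 => /(_ qs); rewrite /tame_check.
have := nth_find point hP; rewrite (nth_map (point, 1%N))//.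
have : (nth (point, 1%N) tame q).1 \in unzip1 tame by apply: map_f; apply: mem_nth.
case: (nth _ tame q) => [M k] /= Mt /asboolP oM /and4P[/andP[/andP[k0 k5] Mw] cH cW mx].
have k6 : (0 < k <= 6)%N by rewrite k0 (leq_trans k5).
have [f [g fg]] := oM.
have noF B : B \in forbidden ++ take q (unzip1 tame) -> ~ occurs B A.
  rewrite mem_cat => /orP[|Bq]; first exact: noB.
  move=> oB; have := mem_take Bq => Bt.
  have := index_ltn Bq.
  move=> /(before_find point); rewrite nth_index// => /negP; apply; exact/asboolP.
have wF : all wf (forbidden ++ take q (unzip1 tame)).
  apply/allP => B; rewrite mem_cat => BF; apply: pw; rewrite mem_cat.
  by case/orP: BF => [->//|/mem_take ->]; rewrite orbT.
have [rho [sig [Ag blow]]] := maximal_blowup wF noF fg mx.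
pose A' := peel A M rho.
have [||k' [k'5 fA' wA']] := IH A'.
- move: cA; rewrite ltnS; apply: leq_trans; apply: proper_card.
  apply/fintype.properP; split; first by apply/fintype.subsetP => p; rewrite !inE => /andP[].
  have r0 : (0 < nrow M)%N by case/and5P: mx.
  have := pz M; rewrite mem_cat Mt orbT => /(_ isT)/allP/(_ 0%N); rewrite in_iota0 => /(_ r0).
  move=> /hasP[j]; rewrite in_iota0 => jc Mj.
  have Aj : A (f 0%N) (g j) by rewrite fg.
  (* An edge of the occurrence that [peel] deletes: were [rho (f 0)] at least [r], row [f 0] would
     vanish on the columns of the occurrence. *)
  exists (f 0%N, g j); rewrite inE//= /A' /peel Aj /= -ltnNge ltnNge; apply/negP => rM.
  by move: Aj; rewrite Ag// ent_row_out.
- move=> B BF oB; apply: (noB B BF); apply: occurs_peel oB.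
  by apply: pz; rewrite mem_cat BF.
have fM := factors_in_host k6 Mw cH.
(* Both factorizations are relaxed to the larger bound; the witness comes from [M] in the first case
   and from the peeled matrix in the second. *)
have [kk|kk] := leqP k' k.
  exists k; split=> //.
    apply: (factors_peel Mw blow fM); apply: factors_le fA'.
    by rewrite schur_eta_le// kk.
  have := allP witness_patterns_ok k; rewrite mem_iota add1n ltnS => /(_ k6) /and3P[w1 w2 _].
  by right; case/orP: cW => cW; [left|right]; apply: occurs_contains cW oM.
exists k'; split=> //.
  apply: (factors_peel Mw blow _ fA'); apply: factors_le fM.
  by rewrite schur_eta_le// ltnW.
case: wA' => [k'0|wA']; first by rewrite k'0 in kk.
have k'6 : (0 < k' <= 6)%N by rewrite (leq_trans _ kk)// (leq_trans k'5).
have := allP witness_patterns_ok k'; rewrite mem_iota add1n ltnS => /(_ k'6) /and5P[_ _ z1 z2 _].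
by right; case: wA' => wA'; [left|right]; apply: occurs_peel wA'.
Qed.

End Classification.

(** * The set of norms, from finite corners to infinite matrices *)

Section NormSpectrum.
Variables (R : realType) (F : pzRingType) (nrm re im : F -> R) (io : {rmorphism R -> F}).
Hypothesis nrmP : real_modulus nrm re im io.
Local Notation eta := (@schur_eta R).
Local Notation norm01 a := (schur_norm_fin nrm (\matrix_(i, j) (a i j)%:R)).

Let norm_le m n (a : 'I_m -> 'I_n -> bool) := schur_norm_le nrmP (a := a).
Let norm_ge m n (a : 'I_m -> 'I_n -> bool) := schur_norm_ge nrmP (a := a).
Let norm_ge0 m n (a : 'I_m -> 'I_n -> bool) := schur_norm_ge0 nrmP a.

Lemma norm_spectrum_fin m n (a : 'I_m -> 'I_n -> bool) :
  (exists2 k, (k <= 5)%N & norm01 a = eta k) \/ eta 6 <= norm01 a.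
Proof.
have [[B [Bf oB]]|nB] := pselect (exists B, B \in forbidden /\ occurs B a).
  right; apply: norm_ge; move: Bf; rewrite mem_cat => /orP[] /mapP[x xf Bx].
    by apply: (@check_dualP R 6 x isT (allP forbidden_ok x xf)); left; rewrite -Bx.
  by apply: (@check_dualP R 6 x isT (allP forbidden_ok x xf)); right; rewrite -Bx.
have [|k [k5 fk wk]] := @tame_classification R _ _ a.
  by move=> B Bf oB; apply: nB; exists B.
left; exists k => //; apply/le_anti; rewrite norm_le ?schur_eta_ge0//=.
case: wk => [->|wk]; first exact: norm_ge0.
have [->|k0] := posnP k; first exact: norm_ge0.
have k6 : (0 < k <= 6)%N by rewrite k0 (leq_trans k5).
apply: norm_ge; apply: (@check_dualP R k (witness k)) => //.
by have := allP witness_ok k; rewrite mem_iota add1n ltnS => /(_ k6).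
Qed.

(** The norm is attained by the witness pattern extended by zeros: it embeds in the host, so every
    corner factors with bound [eta k], and the corner of size 5 already contains it. *)
Lemma norm_spectrum_attained k : (k <= 6)%N -> idem_schur_norms nrm (eta k).
Proof.
move=> k6; have [->|k0] := posnP k.
  exists (fun _ _ => false); apply/le_anti/andP; split.
    apply: ge_ereal_sup => _ [N _ <-]; rewrite lee_fin; apply: norm_le => //.
    exact: factors0.
  apply: ereal_sup_ubound; exists 0%N => //; congr EFin; apply/le_anti.
  by rewrite norm_ge0 andbT norm_le//; apply: factors0.
have kk : (0 < k <= 6)%N by rewrite k0.
have := allP witness_patterns_ok k; rewrite mem_iota add1n ltnS => /(_ kk).
move=> /and5P[Ww _ _ _ /and3P[r5 c5 cW]]; set W := dd_pat (witness k) in Ww r5 c5 cW *.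
have fW := factors_in_host R kk Ww cW.
have up N : schur_norm_fin nrm (corner F (ent W) N) <= eta k.
  apply: norm_le; first exact: schur_eta_ge0.
  move: fW => [K [d [u [v [d0 uv uc vc]]]]]; exists K, d, (u \o val), (v \o val).
  by split=> // [i j|i|j]; [exact: uv|exact: uc|exact: vc].
exists (ent W); apply/le_anti/andP; split.
  by apply: ge_ereal_sup => _ [N _ <-]; rewrite lee_fin.
apply: ereal_sup_ubound; exists 5%N => //; congr EFin; apply/le_anti.
rewrite up norm_ge//; apply: (@check_dualP R k (witness k)) => //.
  by have := allP witness_ok k; rewrite mem_iota add1n ltnS => /(_ kk).
left; exists inord, inord => i j ir jc.
by rewrite !inordK ?(leq_trans ir)// (leq_trans jc).
Qed.

(** If no corner reaches [eta 6], the corner norms take finitely many values, so their supremum is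
    the one with the largest index. *)
Lemma norm_spectrum x : idem_schur_norms nrm x ->
  (exists2 k, (k <= 5)%N & x = eta k) \/ eta 6 <= x.
Proof.
move=> [a ax].
have le N : schur_norm_fin nrm (corner F a N) <= x.
  by rewrite -lee_fin -ax; apply: ereal_sup_ubound; exists N.
have [[N hN]|small] := pselect (exists N, eta 6 <= schur_norm_fin nrm (corner F a N)).
  by right; apply: le_trans (le N).
left; pose hit k := `[< exists N, schur_norm_fin nrm (corner F a N) = eta k >] && (k <= 5)%N.
have each N : exists2 k, (k <= 5)%N & schur_norm_fin nrm (corner F a N) = eta k.
  by have [//|hN] := norm_spectrum_fin (fun i j : 'I_N => a i j); case: small; exists N.
have ex : exists k, hit k.
  by have [k k5 e] := each 0%N; exists k; rewrite /hit k5 andbT; apply/asboolP; exists 0%N.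
have ub k : hit k -> (k <= 5)%N by move=> /andP[].
case: (ex_maxnP ex ub) => k /andP[/asboolP[N eN] k5] kmax.
exists k => //; apply/le_anti; rewrite -{2}eN le andbT -lee_fin -ax.
apply: ge_ereal_sup => _ [N' _ <-]; rewrite lee_fin.
have [l l5 el] := each N'; rewrite el schur_eta_le// k5 andbT kmax// /hit l5 andbT.
by apply/asboolP; exists N'.
Qed.

End NormSpectrum.

(** * Real and complex scalars *)

Lemma real_modulus_real (R : realType) :
  @real_modulus R R (fun x => `|x|) id (fun=> 0) idfun.
Proof.
split=> //=; last by move=> r x; rewrite mulrC.
- by move=> x; rewrite expr0n addr0 sqrtr_sqr.
- exact: normrM.
- by move=> _ _; rewrite addr0.
- by move=> r _; rewrite mulr0.
Qed.

Lemma real_modulus_complex (R : realType) :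
  @real_modulus R R[i] (@Normc.normc R) (@complex.Re R) (@complex.Im R) (real_complex R).
Proof.
split=> //=.
- by case.
- exact: Normc.normcM.
- by move=> [? ?] [].
- by move=> [? ?] [].
- by move=> r [a b] /=; rewrite mul0r subr0.
- by move=> r [a b] /=; rewrite mul0r addr0.
- by move=> r x; rewrite mulrC.
Qed.

Theorem theorem1p1 (R : realType) :
  forall NS : set R, (NS = @NormsR R \/ NS = @NormsC R) ->
    (forall k : nat, (k <= 6)%N -> NS (@schur_eta R k)) /\
    (forall x : R, NS x ->
       (exists2 k : nat, (k <= 5)%N & x = @schur_eta R k) \/ @schur_eta R 6 <= x).
Proof.
move=> NS [] ->; split=> [k|x].
- exact: (norm_spectrum_attained (real_modulus_real R)).
- exact: (norm_spectrum (real_modulus_real R)).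
- exact: (norm_spectrum_attained (real_modulus_complex R)).
- exact: (norm_spectrum (real_modulus_complex R)).
Qed.
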